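(* Suppose $1\le k\le\frac n2-\sqrt n$. There exist universal constants $C,c>0$ such that $$\inf_{\hat\theta}\ \sup_{\theta\in\mathbb{R},\ \|\gamma\|_0\le k}P_{\theta,\gamma}\left\{|\hat\theta-\theta|>C\frac kn\log^{-1/2}\Big(1+\frac{k^2(n-2k)^2}{n^3}\Big)\right\}\ge c,$$ where the infimum is over all estimators (measurable functions of $X_1,\dots,X_n$).
   Context: Model: for an integer $n\ge 2$, observations $X_j=\theta+\gamma_j+ Z_j$, $j=1,\dots,n$ (unit variance), where $\theta\in\mathbb{R}$, $\gamma\in\mathbb{R}^n$ and $Z_1,\dots,Z_n$ are i.i.d. $N(0,1)$; $P_{\theta,\gamma}$ denotes the joint law of $(X_1,\dots,X_n)$. $\|\gamma\|_0=\#\{j:\gamma_j\neq 0\}$. *)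

(* Defs.v *)
From HB Require Import structures.
From mathcomp Require Import all_boot all_order all_algebra.
From mathcomp Require Import all_classical all_reals all_analysis.
Set Implicit Arguments. Unset Strict Implicit. Unset Printing Implicit Defensive.
Import Order.TTheory GRing.Theory Num.Theory.
Local Open Scope classical_set_scope.
Local Open Scope ring_scope.
Local Open Scope ereal_scope.

(* Iterated integral of f : n.-tuple R -> \bar R against the product of the
   one-dimensional laws N(mu_1,1) x ... x N(mu_n,1) (coordinate 1 outermost).
   By Tonelli this is the integral w.r.t. the n-fold product Gaussian measure. *)
Fixpoint gauss_iint {R : realType} (n : nat) :
    n.-tuple R -> (n.-tuple R -> \bar R) -> \bar R :=
  match n return n.-tuple R -> (n.-tuple R -> \bar R) -> \bar R with
  | 0 => fun _ f => f [tuple]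
  | n'.+1 => fun mu f =>
      \int[normal_prob (thead mu) 1%R]_y
         gauss_iint (behead_tuple mu) (fun t => f [tuple of y :: t])
  end.

(* Mean vector of X_j = theta + gamma_j + Z_j. *)
Definition mean_vec {R : realType} (n : nat) (theta : R) (gamma : n.-tuple R)
  : n.-tuple R := [tuple of map (fun g => theta + g)%R gamma].

Definition P_tg {R : realType} (n : nat) (theta : R) (gamma : n.-tuple R)
  (A : set (n.-tuple R)) : \bar R :=
  gauss_iint (mean_vec theta gamma) (fun x => (\1_A x)%:E).

Definition l0norm {R : realType} (n : nat) (gamma : n.-tuple R) : nat :=
  count (fun g => g != 0%R) gamma.

(* Main.v *)
(** Le Cam's method with two product priors on the mean vector: every coordinate
    equals theta with probability 1 - p and is an outlier otherwise, with p
    slightly below k/n so that at most k outliers occur with high probability.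
    The marginal laws of one observation are finite Gaussian location mixtures
    whose difference is w (d_t - d_0 - nu) * N(0,1), where w is of order 1 - 2p
    and nu is any signed measure of mass 0 and total variation at most p.

    The chi-square distance of the two mixtures is controlled by
    w^2 * sum_(x, y) mu_x mu_y exp(x y) with mu = d_t - d_0 - nu, that is, by the
    values on the support of mu of its Laplace transform.  If
    k^2 (n - 2k)^2 / n^3 is bounded, nu = 0 is good enough, with t of order
    sqrt n / (n - 2k).  Otherwise nu comes from truncating, after K terms, the
    expansion of sinh (tau u) in powers of sinh u (u = h y), which is the one of
    sin (tau asin s) with alternating signs: an odd power of sinh (h y) is the
    Laplace transform of a measure of total mass 1 on multiples of h, the
    coefficients sum to O(tau), and for h of order K^(-1/2) the remainder is
    O(tau 4^(-K)) on the whole support of nu.  With tau = p / 4 and 4^K of order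
    k^2 (n - 2k)^2 / n^3 the separation is t = p h / 2, of order (k/n) K^(-1/2). *)

Require Import Defs.
From HB Require Import structures.
From mathcomp Require Import all_boot all_order all_algebra.
From mathcomp Require Import all_classical all_reals all_analysis.
From mathcomp Require Import measurable_realfun ring lra.
Set Implicit Arguments.
Unset Strict Implicit.
Unset Printing Implicit Defensive.

Import Order.TTheory GRing.Theory Num.Theory.
Import numFieldNormedType.Exports.
Local Open Scope classical_set_scope.
Local Open Scope ring_scope.

(** * Gaussian mixtures *)

Section gaussian_integrals.
Import HBNNSimple.
Local Open Scope ereal_scope.

(** By monotone convergence both sides are limits along simple functions increasing to [h];
    linearity then leaves only indicators, where the hypothesis on [nu] applies. *)
Lemma ge0_integral_density d (T : measurableType d) (R : realType)
    (nu mu : {measure set T -> \bar R}) (g : T -> R) (h : T -> \bar R) :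
  measurable_fun setT g -> (forall x, 0 <= g x)%R ->
  (forall A, measurable A -> nu A = \int[mu]_(x in A) (g x)%:E) ->
  measurable_fun setT h -> (forall x, 0 <= h x) ->
  \int[nu]_x h x = \int[mu]_x (h x * (g x)%:E).
Proof.
move=> mg g0 nuE mh h0; pose f_ := nnsfun_approx measurableT mh.
have mf_ n : measurable_fun setT (fun x => (f_ n x)%:E).
  by apply/measurable_EFinP/measurable_funP.
have mgE : measurable_fun setT (fun x => (g x)%:E) by exact/measurable_EFinP.
transitivity (lim (\int[nu]_x (f_ n x)%:E @[n --> \oo])).
  rewrite -monotone_convergence//=.
  - apply: eq_integral => x _; apply/esym/cvg_lim => //=.
    exact: cvg_nnsfun_approx.
  - by move=> n ? _; rewrite lee_fin.
  - by move=> ? _ ? ? mn; rewrite lee_fin; exact/lefP/nd_nnsfun_approx.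
transitivity (lim (\int[mu]_x ((f_ n x)%:E * (g x)%:E) @[n --> \oo])); last first.
  rewrite -monotone_convergence//=.
  - apply: eq_integral => x _; apply/cvg_lim => //=.
    by apply: cvgeZr => //; exact: cvg_nnsfun_approx.
  - by move=> n; exact: emeasurable_funM.
  - by move=> n x _; rewrite mule_ge0 ?lee_fin.
  - move=> x _ a b ab; rewrite lee_wpmul2r ?lee_fin//.
    exact/lefP/nd_nnsfun_approx.
apply: congr_lim; apply/funext => n /=; set f := f_ n.
have mind r : measurable_fun setT (fun x => (\1_(f @^-1` [set r]) x)%:E : \bar R).
  by apply/measurable_EFinP; exact: measurable_indic.
under [LHS]eq_integral do rewrite fimfunE -fsumEFin//.
under [RHS]eq_integral.
  move=> x _; rewrite fimfunE -fsumEFin// ge0_mule_fsuml; last first.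
    by move=> r; rewrite EFinM nnfun_muleindic_ge0.
  over.
rewrite [LHS]ge0_integral_fsum//; last 2 first.
  - by move=> r; exact/measurable_EFinP/measurableT_comp.
  - by move=> r x _; rewrite EFinM nnfun_muleindic_ge0.
rewrite [RHS]ge0_integral_fsum//; last 2 first.
  - by move=> r; apply: emeasurable_funM => //; exact/measurable_EFinP/measurableT_comp.
  - by move=> r x _; rewrite mule_ge0 ?lee_fin// -lee_fin EFinM nnfun_muleindic_ge0.
apply: eq_fsbigr => r; rewrite inE => -[x _ <-{r}].
have mA : measurable (f @^-1` [set f x]) by exact: measurable_sfunP.
under eq_integral do rewrite EFinM.
rewrite ge0_integralZl ?lee_fin//.
under [RHS]eq_integral do rewrite EFinM -muleA.
rewrite ge0_integralZl ?lee_fin//; first last.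
- by move=> y _; rewrite -EFinM lee_fin mulr_ge0.
- by apply: emeasurable_funM => //; exact/measurable_EFinP.
congr (_ * _); rewrite integral_indic// setIT nuE// integral_mkcond/=.
apply: eq_integral => y _; rewrite patchE indicE.
by case: ifPn => _; rewrite ?mul1e ?mul0e.
Qed.

(** The likelihood ratio of N(m,1) against N(0,1) at [x]. *)
Definition gexp {R : realType} (m x : R) : R := expR (m * x - m ^+ 2 / 2).

Lemma gexp_gt0 (R : realType) (m x : R) : (0 < gexp m x)%R.
Proof. exact: expR_gt0. Qed.

Lemma measurable_gexp (R : realType) (m : R) : measurable_fun setT (gexp m).
Proof.
by apply: measurableT_comp => //; exact: measurable_funB.
Qed.

(** Completing the square. The factor [expR (a * b)] is what later turns chi-square distances into
    values of Laplace transforms. *)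
Lemma gexpM (R : realType) (a b x : R) :
  (gexp a x * gexp b x = expR (a * b) * gexp (a + b) x)%R.
Proof. by rewrite /gexp -!expRD; congr expR; field. Qed.

Lemma gexp0 (R : realType) (x : R) : gexp 0 x = 1%R.
Proof. by rewrite /gexp mul0r expr0n mul0r subrr expR0. Qed.

Lemma ge0_integral_normal_shift (R : realType) (m : R) (h : R -> \bar R) :
  measurable_fun setT h -> (forall x, 0 <= h x) ->
  \int[normal_prob m 1%R]_x h x
  = \int[normal_prob 0%R 1%R]_x (h x * (gexp m x)%:E).
Proof.
move=> mh h0; have mg := @measurable_gexp R m.
rewrite (@ge0_integral_density _ _ _ (normal_prob m 1%R) lebesgue_measure _ _
  (measurable_normal_pdf m 1%R) (normal_pdf_ge0 m 1%R) (fun A _ => erefl) mh h0).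
rewrite (@ge0_integral_density _ _ _ (normal_prob 0 1%R) lebesgue_measure _ _
  (measurable_normal_pdf 0%R 1%R) (normal_pdf_ge0 0%R 1%R) (fun A _ => erefl)).
- apply: eq_integral => x _; rewrite -muleA -EFinM.
  congr (_ * _%:E); rewrite !normal_pdfE ?oner_neq0// mulrCA; congr (_ * _)%R.
  by rewrite /gexp /normal_fun -expRD; congr expR; field.
- by apply: emeasurable_funM => //; exact/measurable_EFinP.
- by move=> x; rewrite mule_ge0// lee_fin ltW// gexp_gt0.
Qed.

Lemma integral_gexp (R : realType) (m : R) :
  \int[normal_prob 0%R 1%R]_x (gexp m x)%:E = 1.
Proof.
have := @ge0_integral_normal_shift R m (cst 1) (measurable_cst _) (fun=> lee01).
rewrite integral_cst//= probability_setT mul1e => ->.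
by apply: eq_integral => x _; rewrite mul1e.
Qed.

Lemma integrable_gexp (R : realType) (m : R) :
  (normal_prob 0%R 1%R).-integrable setT (fun x : measurableTypeR R => (gexp m x)%:E).
Proof.
apply/integrableP; split.
  by apply/measurable_EFinP; exact: measurable_gexp.
under eq_integral do rewrite gee0_abs ?lee_fin ?ltW ?gexp_gt0//.
by rewrite integral_gexp ltry.
Qed.

(* The pair [a] in [s] stands for the (signed) mass [a.2] at the point [a.1];
   [gmix s] is the density, with respect to N(0,1), of the convolution of the
   discrete signed measure [s] with N(0,1). *)
Definition gmix {R : realType} (s : seq (R * R)) (x : R) : R :=
  \sum_(a <- s) a.2 * gexp a.1 x.

Lemma measurable_gmix (R : realType) (s : seq (R * R)) :
  measurable_fun setT (gmix s).
Proof.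
apply: measurable_sum => a; apply: measurable_funM => //.
exact: measurable_gexp.
Qed.

Lemma integral_gmix (R : realType) (s : seq (R * R)) :
  \int[normal_prob 0%R 1%R]_x (gmix s x)%:E = (\sum_(a <- s) a.2)%:E.
Proof.
under eq_integral do rewrite /gmix -sumEFin.
rewrite integral_sum//=; last first.
  by move=> a; under eq_fun do rewrite EFinM; exact/integrableZl/integrable_gexp.
rewrite -sumEFin; apply: eq_bigr => a _.
under eq_integral do rewrite EFinM.
by rewrite integralZl ?integral_gexp ?mule1//; exact: integrable_gexp.
Qed.

End gaussian_integrals.

(** * Iterated integrals against the standard Gaussian law *)

Section iterated_integrals.
Variable R : realType.
Local Open Scope ereal_scope.

Fixpoint std_iint (n : nat) : (n.-tuple R -> \bar R) -> \bar R :=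
  match n return (n.-tuple R -> \bar R) -> \bar R with
  | 0 => fun f => f [tuple]
  | n'.+1 => fun f =>
      \int[normal_prob 0%R 1%R]_y std_iint (fun t => f [tuple of y :: t])
  end.

Lemma eq_std_iint n (f g : n.-tuple R -> \bar R) :
  f =1 g -> std_iint f = std_iint g.
Proof. by move=> fg; congr std_iint; apply/funext. Qed.

Lemma std_iint_ge0 n (f : n.-tuple R -> \bar R) :
  (forall t, 0 <= f t) -> 0 <= std_iint f.
Proof.
elim: n f => [|n IH] f f0 /=; first exact: f0.
by apply: integral_ge0 => y _; exact: IH.
Qed.

(** The parameter space is arbitrary because the induction moves each outer coordinate into the
    parameter; Fubini-Tonelli handles one coordinate at a time. *)
Lemma measurable_std_iint_param n d (T : measurableType d)
    (F : T * n.-tuple R -> \bar R) :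
  measurable_fun setT F -> (forall z, 0 <= F z) ->
  measurable_fun setT (fun z => std_iint (fun t => F (z, t))).
Proof.
elim: n d T F => [|n IH] d T F mF F0 /=.
  by apply: (measurableT_comp mF); exact: measurable_fun_pair.
pose G (zy : T * R) := std_iint (fun t => F (zy.1, [tuple of zy.2 :: t])).
have mG : measurable_fun setT G.
  apply: (IH _ _ (fun u : (T * R) * n.-tuple R =>
    F (u.1.1, [tuple of u.1.2 :: u.2]))) => //.
  apply: (measurableT_comp mF); apply: measurable_fun_pair.
    exact: measurableT_comp.
  by apply: measurable_cons => //; exact: measurableT_comp.
have G0 zy : 0 <= G zy by apply: std_iint_ge0.
exact: (@measurable_fun_fubini_tonelli_F _ _ T _ R (normal_prob 0%R 1%R) G mG G0).
Qed.

Lemma measurable_cons_section n (f : n.+1.-tuple R -> \bar R) (y : R) :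
  measurable_fun setT f -> measurable_fun setT (fun t : n.-tuple R => f [tuple of y :: t]).
Proof. by move=> mf; apply: (measurableT_comp mf); exact: measurable_cons. Qed.

Lemma measurable_std_iint n (f : n.+1.-tuple R -> \bar R) :
  measurable_fun setT f -> (forall t, 0 <= f t) ->
  measurable_fun setT (fun y => std_iint (fun t => f [tuple of y :: t])).
Proof.
move=> mf f0.
apply: (@measurable_std_iint_param n _ _
  (fun u : R * n.-tuple R => f [tuple of u.1 :: u.2])) => //.
by apply: (measurableT_comp mf); exact: measurable_cons.
Qed.

Lemma le_std_iint n (f g : n.-tuple R -> \bar R) :
  measurable_fun setT f -> measurable_fun setT g -> (forall t, 0 <= f t) ->
  (forall t, f t <= g t) -> std_iint f <= std_iint g.
Proof.
elim: n f g => [|n IH] f g mf mg f0 fg /=; first exact: fg.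
have g0 t : 0 <= g t by exact: le_trans (f0 t) (fg t).
apply: ge0_le_integral => //.
- by move=> y _; exact: std_iint_ge0.
- exact: measurable_std_iint.
- exact: measurable_std_iint.
- by move=> y _; apply: IH => //; exact: measurable_cons_section.
Qed.

Lemma std_iintD n (f g : n.-tuple R -> \bar R) :
  measurable_fun setT f -> measurable_fun setT g ->
  (forall t, 0 <= f t) -> (forall t, 0 <= g t) ->
  std_iint (fun t => f t + g t) = std_iint f + std_iint g.
Proof.
elim: n f g => [//|n IH] f g mf mg f0 g0 /=.
rewrite -ge0_integralD//.
- by apply: eq_integral => y _; rewrite IH//; exact: measurable_cons_section.
- by move=> y _; exact: std_iint_ge0.
- exact: measurable_std_iint.
- by move=> y _; exact: std_iint_ge0.
- exact: measurable_std_iint.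
Qed.

Lemma std_iintZl n (c : R) (f : n.-tuple R -> \bar R) :
  measurable_fun setT f -> (forall t, 0 <= f t) -> (0 <= c)%R ->
  std_iint (fun t => c%:E * f t) = c%:E * std_iint f.
Proof.
elim: n f => [//|n IH] f mf f0 c0 /=.
rewrite -ge0_integralZl//.
- by apply: eq_integral => y _; rewrite IH//; exact: measurable_cons_section.
- exact: measurable_std_iint.
- by move=> y _; exact: std_iint_ge0.
Qed.

Lemma std_iint_sum n (I : eqType) (s : seq I) (c : I -> R)
    (f : I -> n.-tuple R -> \bar R) :
  (forall i, measurable_fun setT (f i)) -> (forall i t, 0 <= f i t) ->
  {in s, forall i, (0 <= c i)%R} ->
  std_iint (fun t => \sum_(i <- s) (c i)%:E * f i t)
  = \sum_(i <- s) (c i)%:E * std_iint (f i).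
Proof.
move=> mf f0; elim: s => [_|i s IH c0].
  rewrite big_nil (@eq_std_iint _ _ (fun t => 0%:E * 0)); last first.
    by move=> t; rewrite big_nil mule0.
  by rewrite std_iintZl// mul0e.
have ci : (0 <= c i)%R by rewrite c0// mem_head.
have cs : {in s, forall j, (0 <= c j)%R} by move=> j js; rewrite c0// inE js orbT.
rewrite big_cons -IH// -std_iintZl// -std_iintD//.
- by apply: eq_std_iint => t; rewrite big_cons.
- by apply: emeasurable_funM.
- by apply: emeasurable_sum => j; exact: emeasurable_funM.
- by move=> t; rewrite mule_ge0 ?lee_fin.
- by move=> t; rewrite big_seq; apply: sume_ge0 => j js; rewrite mule_ge0 ?lee_fin ?cs.
Qed.

Definition tprod n (g : 'I_n -> R -> R) (t : n.-tuple R) : R :=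
  (\prod_(i < n) g i (tnth t i))%R.

Lemma tprod_cons n (g : 'I_n.+1 -> R -> R) y (t : n.-tuple R) :
  (tprod g [tuple of y :: t] = g ord0 y * tprod (fun i => g (lift ord0 i)) t)%R.
Proof.
rewrite /tprod big_ord_recl tnth0; congr (_ * _)%R.
by apply: eq_bigr => i _; rewrite tnthS.
Qed.

Lemma measurable_tprod n (g : 'I_n -> R -> R) :
  (forall i, measurable_fun setT (g i)) -> measurable_fun setT (tprod g).
Proof.
move=> mg; apply: measurable_prod => i _.
by apply: measurableT_comp => //; exact: measurable_tnth.
Qed.

Lemma tprod_ge0 n (g : 'I_n -> R -> R) t :
  (forall i x, (0 <= g i x)%R) -> (0 <= tprod g t)%R.
Proof. by move=> g0; apply: prodr_ge0. Qed.

Lemma std_iint_tprod n (g : R -> R) (q : R) :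
  measurable_fun setT g -> (forall x, (0 <= g x)%R) ->
  \int[normal_prob 0%R 1%R]_x (g x)%:E = q%:E ->
  std_iint (fun t : n.-tuple R => (tprod (fun=> g) t)%:E) = (q ^+ n)%:E.
Proof.
move=> mg g0 gq; have q0 : (0 <= q)%R.
  by rewrite -lee_fin -gq; apply: integral_ge0 => x _; rewrite lee_fin.
elim: n => [|n IH] /=; first by rewrite /tprod big_ord0.
under eq_integral.
  move=> y _; under eq_std_iint do rewrite tprod_cons EFinM.
  rewrite std_iintZl//; first last.
  - by move=> t; rewrite lee_fin tprod_ge0.
  - by apply/measurable_EFinP; exact: measurable_tprod.
  rewrite IH; over.
rewrite ge0_integralZr//=; first by rewrite gq exprS EFinM.
- exact/measurable_EFinP.
- by move=> y _; rewrite lee_fin.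
- by rewrite lee_fin exprn_ge0.
Qed.

(** Change of measure coordinate by coordinate: the means move into a product of likelihood ratios,
    and all parameters share one reference measure. *)
Lemma gauss_iint_std n (m : n.-tuple R) (f : n.-tuple R -> R) :
  measurable_fun setT f -> (forall t, (0 <= f t)%R) ->
  gauss_iint m (fun t => (f t)%:E)
  = std_iint (fun t => (f t * tprod (fun i => gexp (tnth m i)) t)%:E).
Proof.
elim: n m f => [|n IH] m f mf f0 /=.
  by rewrite /tprod big_ord0 mulr1.
have mt k (m' : k.-tuple R) : measurable_fun setT (tprod (fun i => gexp (tnth m' i))).
  by apply: measurable_tprod => i; exact: measurable_gexp.
have t0 k (m' t : k.-tuple R) : (0 <= tprod (fun i => gexp (tnth m' i)) t)%R.
  by apply: tprod_ge0 => i x; rewrite ltW// gexp_gt0.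
have mc (y : R) : measurable_fun setT (fun t : n.-tuple R => f [tuple of y :: t]).
  by apply: (measurableT_comp mf); exact: measurable_cons.
under eq_integral do rewrite IH//.
rewrite ge0_integral_normal_shift//=; last 2 first.
- apply: (@measurable_std_iint_param n _ _ (fun u : R * n.-tuple R =>
    (f [tuple of u.1 :: u.2] *
     tprod (fun i => gexp (tnth (behead_tuple m) i)) u.2)%:E)).
  + apply/measurable_EFinP/measurable_funM; last first.
      exact: (measurableT_comp (mt _ _)).
    by apply: (measurableT_comp mf); exact: measurable_cons.
  + by move=> u; rewrite lee_fin mulr_ge0.
- by move=> y; apply: std_iint_ge0 => t; rewrite lee_fin mulr_ge0.
apply: eq_integral => y _.
rewrite muleC -std_iintZl ?ltW ?gexp_gt0//; last 2 first.
- by apply/measurable_EFinP; exact: measurable_funM (mc y) (mt _ _).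
- by move=> t; rewrite lee_fin mulr_ge0.
apply: eq_std_iint => t.
rewrite -EFinM mulrCA tprod_cons [in RHS](tuple_eta m) tnth0; congr (_ * (_ * _))%:E.
by apply: eq_bigr => i _; rewrite tnthS.
Qed.

End iterated_integrals.

(** * Product priors and Le Cam's method *)

Section product_priors.

(** Since (2a + c/8)^2 - ac = (2a - c/8)^2, the right-hand side dominates the square root of ac. *)
Lemma le_amgm (K : realFieldType) (a b c : K) :
  0 <= a -> 0 <= b -> 0 <= c -> b ^+ 2 <= a * c -> b <= 2 * a + 8^-1 * c.
Proof.
move=> a0 b0 c0 bac; rewrite -(@ler_pXn2r _ 2) ?nnegrE//; last by lra.
have := sqr_ge0 (2 * a - 8^-1 * c); nra.
Qed.

Variable R : realType.
Local Open Scope ereal_scope.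

(** For a probability [s], the expectation of [F] at a vector with i.i.d. coordinates of law [s].
    Finite support makes it a nested sum. *)
Fixpoint avg (s : seq (R * R)) (n : nat) : (n.-tuple R -> \bar R) -> \bar R :=
  match n return (n.-tuple R -> \bar R) -> \bar R with
  | 0 => fun F => F [tuple]
  | n'.+1 => fun F =>
      \sum_(a <- s) a.2%:E * avg s (fun m => F [tuple of a.1 :: m])
  end.

Definition nonneg_weights (s : seq (R * R)) := {in s, forall a, (0 <= a.2)%R}.

Lemma eq_avg s n (F G : n.-tuple R -> \bar R) : F =1 G -> avg s F = avg s G.
Proof. by move=> FG; congr avg; apply/funext. Qed.

Lemma avg_ge0 s n (F : n.-tuple R -> \bar R) :
  nonneg_weights s -> (forall m, 0 <= F m) -> 0 <= avg s F.
Proof.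
move=> s0; elim: n F => [|n IH] F F0 /=; first exact: F0.
rewrite big_seq; apply: sume_ge0 => a sa.
by rewrite mule_ge0 ?lee_fin ?s0// IH.
Qed.

Lemma le_avg s n (F G : n.-tuple R -> \bar R) :
  nonneg_weights s -> (forall m, F m <= G m) -> avg s F <= avg s G.
Proof.
move=> s0; elim: n F G => [|n IH] F G FG /=; first exact: FG.
rewrite big_seq [leRHS]big_seq; apply: lee_sum => a sa.
by rewrite lee_wpmul2l ?lee_fin ?s0// IH.
Qed.

Lemma avgD s n (F G : n.-tuple R -> \bar R) :
  nonneg_weights s -> (forall m, 0 <= F m) -> (forall m, 0 <= G m) ->
  avg s (fun m => F m + G m) = avg s F + avg s G.
Proof.
move=> s0; elim: n F G => [//|n IH] F G F0 G0 /=.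
rewrite -big_split/=; apply: eq_big_seq => a sa.
by rewrite IH// ge0_muleDr ?avg_ge0.
Qed.

Lemma avg_tprod s n (c : R) (u : 'I_n -> R -> R) :
  avg s (fun m => (c * tprod u m)%:E)
  = (c * \prod_(i < n) \sum_(a <- s) a.2 * u i a.1)%:E.
Proof.
elim: n c u => [|n IH] c u /=; first by rewrite /tprod !big_ord0.
rewrite big_ord_recl mulrA mulr_sumr mulr_suml -sumEFin.
apply: eq_bigr => a _; under eq_avg do rewrite tprod_cons mulrA.
by rewrite IH -EFinM; congr EFin; rewrite !mulrA [(c * a.2)%R]mulrC.
Qed.

Lemma avg_cst s n (c : R) : (\sum_(a <- s) a.2 = 1)%R ->
  avg s (fun _ : n.-tuple R => c%:E) = c%:E.
Proof.
move=> s1; elim: n => [//|n IH] /=.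
by under eq_bigr do rewrite IH -EFinM; rewrite sumEFin -mulr_suml s1 mul1r.
Qed.

Lemma measurable_avg s n p (H : n.-tuple R -> p.-tuple R -> \bar R) :
  (forall m, measurable_fun setT (H m)) ->
  measurable_fun setT (fun t => avg s (H ^~ t)).
Proof.
elim: n H => [|n IH] H mH /=; first exact: mH.
by apply: emeasurable_sum => a; apply: emeasurable_funM => //; exact: IH.
Qed.

Lemma avg_std_iint s n p (H : n.-tuple R -> p.-tuple R -> \bar R) :
  nonneg_weights s ->
  (forall m, measurable_fun setT (H m)) -> (forall m t, 0 <= H m t) ->
  avg s (fun m => std_iint (H m)) = std_iint (fun t => avg s (H ^~ t)).
Proof.
move=> s0; elim: n H => [//|n IH] H mH H0 /=.
rewrite std_iint_sum//.
- by apply: eq_bigr => a _; rewrite IH.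
- by move=> a; exact: measurable_avg.
- by move=> a t; exact: avg_ge0.
Qed.

(** Finite sums commute with the integral, and the averaged likelihood ratio factors over the
    coordinates: i.i.d. random means give i.i.d. observations of density [gmix s]. *)
Lemma avg_gauss_iint s n (f : n.-tuple R -> R) :
  nonneg_weights s -> measurable_fun setT f -> (forall t, (0 <= f t)%R) ->
  avg s (fun m => gauss_iint m (fun t => (f t)%:E))
  = std_iint (fun t => (f t * tprod (fun=> gmix s) t)%:E).
Proof.
move=> s0 mf f0; under eq_avg do rewrite gauss_iint_std//.
rewrite avg_std_iint//.
- apply: eq_std_iint => t.
  rewrite (@avg_tprod s n (f t) (fun i v => gexp v (tnth t i))).
  by congr (_ * _)%:E; apply: eq_bigr.
- move=> m; apply/measurable_EFinP/measurable_funM => //.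
  by apply: measurable_tprod => i; exact: measurable_gexp.
- move=> m t; rewrite lee_fin mulr_ge0// tprod_ge0// => i x.
  by rewrite ltW// gexp_gt0.
Qed.

Lemma gmix_ge0 (s : seq (R * R)) x : nonneg_weights s -> (0 <= gmix s x)%R.
Proof.
move=> s0; rewrite /gmix big_seq; apply: sumr_ge0 => a sa.
by rewrite mulr_ge0 ?s0// ltW ?gexp_gt0.
Qed.

(** [h] majorises the chi-square integrand, the square of [gmix s1] over [gmix s0], while staying a
    Gaussian mixture of explicit mass. [le_amgm] bounds the product density of [s1] by twice that of
    [s0] plus one eighth of that of [h]; the latter integrates to at most 2, whence 1/4. *)
Lemma avg_gauss_iint_le n (s0 s1 h : seq (R * R)) (A : set (n.-tuple R)) :
  measurable A -> nonneg_weights s0 -> nonneg_weights s1 ->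
  (forall x, 0 <= gmix h x)%R ->
  (forall x, gmix s1 x ^+ 2 <= gmix s0 x * gmix h x)%R ->
  ((\sum_(a <- h) a.2) ^+ n <= 2)%R ->
  avg s1 (fun m => gauss_iint m (fun t => (\1_A t)%:E))
  <= 2%:E * avg s0 (fun m => gauss_iint m (fun t => (\1_A t)%:E)) + (1 / 4)%:E.
Proof.
move=> mA ws0 ws1 h0 hle hn.
have mI : measurable_fun setT (\1_A : n.-tuple R -> R) by exact: measurable_indic.
have I0 t : (0 <= \1_A t :> R)%R by [].
have mG (s : seq (R * R)) : measurable_fun setT (tprod (fun _ : 'I_n => gmix s)).
  by apply: measurable_tprod => i; exact: measurable_gmix.
have G0 s t : nonneg_weights s -> (0 <= tprod (fun _ : 'I_n => gmix s) t)%R.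
  by move=> ws; apply: tprod_ge0 => i x; exact: gmix_ge0.
have H0 t : (0 <= tprod (fun _ : 'I_n => gmix h) t)%R by exact: tprod_ge0.
have mIG (s : seq (R * R)) : measurable_fun setT
    (fun t => (\1_A t * tprod (fun _ : 'I_n => gmix s) t)%:E : \bar R).
  by apply/measurable_EFinP; exact: measurable_funM.
rewrite !avg_gauss_iint// -std_iintZl//; last first.
  by move=> t; rewrite lee_fin mulr_ge0 ?G0.
apply: (@le_trans _ _ (std_iint (fun t =>
    2%:E * (\1_A t * tprod (fun _ : 'I_n => gmix s0) t)%:E +
    (1 / 8)%:E * (tprod (fun _ : 'I_n => gmix h) t)%:E))).
  apply: le_std_iint => //.
  - apply: emeasurable_funD; apply: emeasurable_funM => //.
    exact/measurable_EFinP.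
  - by move=> t; rewrite lee_fin mulr_ge0 ?G0.
  - move=> t; rewrite -!EFinM -EFinD lee_fin.
    have : (tprod (fun _ : 'I_n => gmix s1) t ^+ 2
        <= tprod (fun _ : 'I_n => gmix s0) t * tprod (fun _ : 'I_n => gmix h) t)%R.
      rewrite /tprod -prodrXl -big_split/=; apply: ler_prod => i _.
      by rewrite exprn_even_ge0//= hle.
    move: (G0 s0 t ws0) (G0 s1 t ws1) (H0 t) => /=.
    rewrite indicE; case: (t \in A) => /=; rewrite ?mul1r ?mul0r.
      by move=> a0 b0 c0 bac; exact: le_amgm bac.
    by move=> _ _ h0t _; lra.
rewrite std_iintD//.
- rewrite leeD2l// std_iintZl//; last first.
    by apply/measurable_EFinP.
  rewrite (std_iint_tprod n _ _ (integral_gmix h))//; last exact: measurable_gmix.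
  by rewrite -EFinM lee_fin; lra.
- exact: emeasurable_funM.
- by apply: emeasurable_funM => //; exact/measurable_EFinP.
- by move=> t; rewrite -EFinM lee_fin !mulr_ge0 ?G0.
- by move=> t; rewrite -EFinM lee_fin !mulr_ge0.
Qed.

End product_priors.

(** * Reduction to two hypotheses *)

Section le_cam.
Variable R : realType.
Local Open Scope ereal_scope.

Lemma gauss_iint1 n (m : n.-tuple R) : gauss_iint m (fun=> 1) = 1.
Proof.
elim: n m => [//|n IH] m /=; under eq_integral do rewrite IH.
by rewrite integral_cst//= probability_setT mule1.
Qed.

Lemma gexp_tprod_ge0 n (m t : n.-tuple R) :
  (0 <= tprod (fun i => gexp (tnth m i)) t)%R.
Proof. by apply: tprod_ge0 => i x; rewrite ltW// gexp_gt0. Qed.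

Lemma measurable_gexp_tprod n (m : n.-tuple R) (f : n.-tuple R -> R) :
  measurable_fun setT f ->
  measurable_fun setT
    (fun t => (f t * tprod (fun i => gexp (tnth m i)) t)%:E : \bar R).
Proof.
move=> mf; apply/measurable_EFinP/measurable_funM => //.
by apply: measurable_tprod => i; exact: measurable_gexp.
Qed.

Lemma le_gauss_iint n (m : n.-tuple R) (f g : n.-tuple R -> R) :
  measurable_fun setT f -> measurable_fun setT g -> (forall t, 0 <= f t)%R ->
  (forall t, f t <= g t)%R ->
  gauss_iint m (fun t => (f t)%:E) <= gauss_iint m (fun t => (g t)%:E).
Proof.
move=> mf mg f0 fg; have g0 t : (0 <= g t)%R by exact: le_trans (f0 t) (fg t).
rewrite !gauss_iint_std//; apply: le_std_iint.
- exact: measurable_gexp_tprod.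
- exact: measurable_gexp_tprod.
- by move=> t; rewrite lee_fin mulr_ge0 ?gexp_tprod_ge0.
- by move=> t; rewrite lee_fin ler_wpM2r ?gexp_tprod_ge0.
Qed.

Lemma gauss_iintD n (m : n.-tuple R) (f g : n.-tuple R -> R) :
  measurable_fun setT f -> measurable_fun setT g -> (forall t, 0 <= f t)%R ->
  (forall t, 0 <= g t)%R ->
  gauss_iint m (fun t => (f t + g t)%:E)
  = gauss_iint m (fun t => (f t)%:E) + gauss_iint m (fun t => (g t)%:E).
Proof.
move=> mf mg f0 g0; rewrite !gauss_iint_std//; last 2 first.
- exact: measurable_funD.
- by move=> t; rewrite addr_ge0.
rewrite -std_iintD; first by apply: eq_std_iint => t; rewrite -EFinD mulrDl.
- exact: measurable_gexp_tprod.
- exact: measurable_gexp_tprod.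
- by move=> t; rewrite lee_fin mulr_ge0 ?gexp_tprod_ge0.
- by move=> t; rewrite lee_fin mulr_ge0 ?gexp_tprod_ge0.
Qed.

Lemma gauss_iint_ge0 n (m : n.-tuple R) (f : n.-tuple R -> R) :
  measurable_fun setT f -> (forall t, 0 <= f t)%R ->
  0 <= gauss_iint m (fun t => (f t)%:E).
Proof.
move=> mf f0; rewrite gauss_iint_std//; apply: std_iint_ge0 => t.
by rewrite lee_fin mulr_ge0 ?gexp_tprod_ge0.
Qed.

(** The factor of one coordinate in exp (lam N), N being the number of outliers; the product form
    lets independence compute the exponential moment. *)
Definition outlier (lam theta v : R) : R := if v == theta then 1%R else expR lam.

Lemma tprod_outlier (lam theta : R) n (m : n.-tuple R) :
  (tprod (fun=> outlier lam theta) m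
   = expR (lam * (count (fun v => v != theta) m)%:R))%R.
Proof.
rewrite /tprod -(big_tuple _ _ m xpredT (outlier lam theta)).
elim: (tval m) => [|v s IH]; first by rewrite big_nil mulr0 expR0.
rewrite big_cons IH /= /outlier; case: eqP => _ /=; first by rewrite mul1r.
by rewrite natrD mulrDr mulr1 expRD.
Qed.

(* Exponential Markov inequality: when the number N of outliers exceeds [k], the
   bound [F m <= 1] is absorbed by [exp (lam (N - k))]. *)
Lemma avg_le_sparse n k (s : seq (R * R)) (theta lam c : R)
    (F : n.-tuple R -> \bar R) :
  nonneg_weights s -> (\sum_(a <- s) a.2 = 1)%R -> (0 <= lam)%R -> (0 <= c)%R ->
  (expR (- (lam * k%:R)) *
    (\sum_(a <- s) a.2 * outlier lam theta a.1) ^+ n <= 1 / 8)%R ->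
  (forall m, F m <= 1) ->
  (forall m : n.-tuple R, (count (fun v => v != theta) m <= k)%N -> F m <= c%:E) ->
  avg s F <= (c + 1 / 8)%:E.
Proof.
move=> s0 s1 lam0 c0 tail F1 Fc.
apply: (@le_trans _ _ (avg s (fun m => c%:E +
    (expR (- (lam * k%:R)) * tprod (fun=> outlier lam theta) m)%:E))).
  apply: le_avg => // m; rewrite tprod_outlier -expRD -EFinD.
  have [mk|mk] := leqP (count (fun v => v != theta) m) k.
    by apply: (le_trans (Fc _ mk)); rewrite lee_fin lerDl expR_ge0.
  apply: (le_trans (F1 m)); rewrite lee_fin -[leLHS]add0r lerD//.
  rewrite -[leLHS]expR0 ler_expR addrC subr_ge0 ler_wpM2l// ler_nat.
  exact: ltnW.
rewrite avgD//.
- rewrite avg_cst// EFinD leeD2l// avg_tprod lee_fin.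
  by rewrite prodr_const card_ord.
- move=> m; rewrite lee_fin mulr_ge0 ?expR_ge0// tprod_ge0// => i x.
  by rewrite /outlier; case: ifP; rewrite ?expR_ge0.
Qed.

(** A separation above 2r makes the two error events cover the sample space. Were the supremum below
    1/10, each prior would give its own error event mass at most 1/10 + 1/8, and comparing the two
    laws would bound the total mass under [s1] by 3 (1/10 + 1/8) + 1/4 = 37/40 < 1. *)
Lemma risk_lower_bound n k (theta0 theta1 r lam : R) (s0 s1 h : seq (R * R))
    (est : n.-tuple R -> R) :
  measurable_fun setT est ->
  nonneg_weights s0 -> (\sum_(a <- s0) a.2 = 1)%R ->
  nonneg_weights s1 -> (\sum_(a <- s1) a.2 = 1)%R ->
  (0 <= lam)%R ->
  (expR (- (lam * k%:R)) *
    (\sum_(a <- s0) a.2 * outlier lam theta0 a.1) ^+ n <= 1 / 8)%R ->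
  (expR (- (lam * k%:R)) *
    (\sum_(a <- s1) a.2 * outlier lam theta1 a.1) ^+ n <= 1 / 8)%R ->
  (forall x, 0 <= gmix h x)%R ->
  (forall x, gmix s1 x ^+ 2 <= gmix s0 x * gmix h x)%R ->
  ((\sum_(a <- h) a.2) ^+ n <= 2)%R ->
  (r + r < `|theta1 - theta0|)%R ->
  ((1 / 10)%:E <= ereal_sup
    [set p | exists (theta : R) (gamma : n.-tuple R), (l0norm gamma <= k)%N /\
       p = P_tg theta gamma [set x | (r < `|est x - theta|)%R]])%E.
Proof.
move=> mest ws0 sum0 ws1 sum1 lam0 tail0 tail1 h0 hle hn sep.
pose A theta := [set x : n.-tuple R | (r < `|est x - theta|)%R].
have mA theta : measurable (A theta).
  have -> : A theta = (fun x => `|est x - theta|)%R @^-1` `]r, +oo[%classic.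
    by apply/seteqP; split => x /=; rewrite in_itv/= andbT.
  rewrite -[X in measurable X]setTI.
  have mf : measurable_fun setT (fun x => `|est x - theta|%R).
    by apply: measurableT_comp => //; exact: measurable_funB.
  by apply: mf => //; exact: measurable_itv.
have mI theta : measurable_fun setT (\1_(A theta) : n.-tuple R -> R).
  exact: measurable_indic.
have I0 theta t : (0 <= \1_(A theta) t :> R)%R by [].
have I1 theta m : gauss_iint m (fun t => (\1_(A theta) t)%:E) <= 1.
  rewrite -[leRHS](gauss_iint1 m); apply: (@le_gauss_iint _ _ _ (cst 1%R)) => // t.
  by rewrite /= indicE; case: (_ \in _).
rewrite leNgt; apply/negP => supS.
have Pc theta (m : n.-tuple R) : (count (fun v => v != theta) m <= k)%N ->
    gauss_iint m (fun t => (\1_(A theta) t)%:E) <= (1 / 10)%:E.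
  move=> mk; apply: le_trans (ltW supS); apply: ereal_sup_ubound.
  (* A mean vector [m] corresponds to gamma = m - theta, whose nonzero entries are the outliers of
     [m]. *)
  exists theta, [tuple of map (fun v => v - theta)%R m]; split.
    rewrite /l0norm count_map (eq_count (a2 := fun v => v != theta))// => v /=.
    by rewrite subr_eq0.
  rewrite /P_tg; congr (gauss_iint _ _); apply: eq_from_tnth => i.
  by rewrite !tnth_map addrC subrK.
have c0 : (0 <= 1 / 10 :> R)%R by lra.
have b0 := avg_le_sparse ws0 sum0 lam0 c0 tail0 (I1 theta0) (Pc theta0).
have b1 := avg_le_sparse ws1 sum1 lam0 c0 tail1 (I1 theta1) (Pc theta1).
have := avg_gauss_iint_le (mA theta0) ws0 ws1 h0 hle hn.
apply/negP; rewrite -ltNge.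
apply: (@le_lt_trans _ _ (2%:E * (1 / 10 + 1 / 8)%:E + (1 / 4)%:E)).
  by rewrite leeD2r// lee_wpmul2l// lee_fin.
rewrite -(@lteD2rE _ (1 / 10 + 1 / 8)%:E)//.
apply: (@lt_le_trans _ _ 1); first by rewrite -EFinM -!EFinD lte_fin; lra.
rewrite -(avg_cst n 1 sum1).
apply: (@le_trans _ _ (avg s1 (fun m => gauss_iint m (fun t => (\1_(A theta0) t)%:E)
   + gauss_iint m (fun t => (\1_(A theta1) t)%:E)))).
  apply: le_avg => // m; rewrite -(gauss_iint1 m) -gauss_iintD//.
  apply: (@le_gauss_iint _ _ (cst 1%R)) => //; first exact: measurable_funD.
  move=> t /=; rewrite !indicE; have [|tA0] := boolP (t \in A theta0).
    by case: (t \in A theta1) => /= _; lra.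
  have [_|tA1] := boolP (t \in A theta1); first by rewrite add0r.
  exfalso; move: tA0 tA1; rewrite !notin_setE /A/= => /negP + /negP.
  rewrite -!leNgt => e0 e1; move: sep; apply/negP; rewrite -leNgt.
  rewrite (_ : theta1 - theta0 = (est t - theta0) - (est t - theta1))%R; last by ring.
  by apply: (le_trans (ler_normB _ _)); rewrite lerD.
rewrite avgD//; first by rewrite leeD2l.
- by move=> m; exact: gauss_iint_ge0.
- by move=> m; exact: gauss_iint_ge0.
Qed.

End le_cam.

(** * Contaminated priors with a prescribed signed difference *)

Section prior_pair.
Variable R : realType.
Implicit Types (s nu : seq (R * R)) (p w t x : R).

Definition laplace s (y : R) : R := \sum_(a <- s) a.2 * expR (a.1 * y).

Definition scale_weights (c : R) s : seq (R * R) := [seq (a.1, c * a.2) | a <- s].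

Lemma gmix_cons a s x : gmix (a :: s) x = a.2 * gexp a.1 x + gmix s x.
Proof. by rewrite /gmix big_cons. Qed.

Lemma gmix_cat s1 s2 x : gmix (s1 ++ s2) x = gmix s1 x + gmix s2 x.
Proof. by rewrite /gmix big_cat. Qed.

Lemma gmix_scale c s x : gmix (scale_weights c s) x = c * gmix s x.
Proof.
rewrite /gmix big_map mulr_sumr; apply: eq_bigr => a _ /=.
by rewrite mulrA.
Qed.

Lemma sum_scale_weights c s :
  \sum_(a <- scale_weights c s) a.2 = c * \sum_(a <- s) a.2.
Proof. by rewrite big_map mulr_sumr. Qed.

(** The exponential factor is the one of [gexpM]; with it, the total mass is the integral of the
    squared density under N(0,1). *)
Definition gmix_square s : seq (R * R) :=
  [seq (a.1 + b.1, a.2 * b.2 * expR (a.1 * b.1)) | a <- s, b <- s].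

Lemma gmix_squareE s x : gmix (gmix_square s) x = gmix s x ^+ 2.
Proof.
rewrite /gmix /gmix_square big_allpairs_dep expr2 mulr_suml.
apply: eq_bigr => a _; rewrite mulr_sumr; apply: eq_bigr => b _ /=.
by rewrite mulrACA gexpM mulrA.
Qed.

Lemma sum_gmix_square s :
  \sum_(a <- gmix_square s) a.2 = \sum_(a <- s) a.2 * laplace s a.1.
Proof.
rewrite /gmix_square big_allpairs_dep; apply: eq_bigr => a _.
rewrite mulr_sumr; apply: eq_bigr => b _ /=.
by rewrite mulrA [b.1 * a.1]mulrC.
Qed.

(** Only an inequality, because atoms of [s] at [theta] do not count as outliers. *)
Lemma sum_outlier_le p lam theta s :
  nonneg_weights s -> \sum_(a <- s) a.2 = p -> 0 <= lam ->
  \sum_(a <- (theta, 1 - p) :: s) a.2 * outlier lam theta a.1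
  <= 1 + p * (expR lam - 1).
Proof.
move=> s0 sp lam0; rewrite big_cons /= {1}/outlier eqxx.
have : \sum_(a <- s) a.2 * outlier lam theta a.1 <= p * expR lam.
  rewrite -sp mulr_suml big_seq [leRHS]big_seq; apply: ler_sum => a sa.
  rewrite ler_wpM2l ?s0// /outlier; case: ifP => // _.
  by rewrite -[leLHS]expR0 ler_expR.
by move=> H; lra.
Qed.

Lemma expr1D_le2 (x : R) n : 0 <= 1 + x -> n%:R * x <= 1 / 2 -> (1 + x) ^+ n <= 2.
Proof.
move=> x0 nx; apply: (@le_trans _ _ (expR (1 / 2))).
  apply: (@le_trans _ _ (expR x ^+ n)).
    by rewrite lerXn2r ?nnegrE ?expR_ge0// expR_ge1Dx.
  by rewrite -expRM_natl ler_expR.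
have e0 := expR_gt0 (1 / 2 : R).
have := expR_ge1Dx (- (1 / 2) : R); rewrite expRN.
by rewrite -(ler_pM2r e0) mulVf ?gt_eqF//; lra.
Qed.

(* The perturbation of the two contaminated laws: pi1 - pi0 = w (d_t - d_0 - nu),
   which is achievable with contamination level [p] because [nu] has mass at
   most [p]; the factor 1 - 2p in [w] measures the distance of [p] to 1/2. *)
Definition perturbation t nu : seq (R * R) :=
  (t, 1) :: (0, -1) :: scale_weights (-1) nu.

Lemma risk_lower_bound_signed n k p lam t r nu (est : n.-tuple R -> R) :
  measurable_fun setT est ->
  0 <= p -> p < 1 / 2 -> 0 < t -> 2 * r < t -> 0 <= lam ->
  expR (- (lam * k%:R)) * (1 + p * (expR lam - 1)) ^+ n <= 1 / 8 ->
  \sum_(a <- nu) a.2 = 0 -> \sum_(a <- nu) `|a.2| <= p ->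
  n%:R * (8 * (1 - 2 * p) ^+ 2 *
    \sum_(a <- perturbation t nu) a.2 * laplace (perturbation t nu) a.1) <= 1 ->
  ((1 / 10)%:E <= ereal_sup
    [set q | exists (theta : R) (gamma : n.-tuple R), (l0norm gamma <= k)%N /\
       q = P_tg theta gamma [set x | (r < `|est x - theta|)%R]])%E.
Proof.
move=> mest p0 p2 t0 rt lam0 tail nu0 nup.
set mu := perturbation t nu; set K := (X in 8 * _ * X) => HK.
(* The largest factor keeping [pad] nonnegative for all [nu] of variation up to p: when M = p, [pad]
   equals 2p - 1 + w (1 - p/2) = 0. *)
pose w := (1 - 2 * p) / (1 - p / 2).
pose M := \sum_(a <- nu) `|a.2|.
have M0 : 0 <= M by apply: sumr_ge0.
have w0 : 0 <= w by rewrite divr_ge0//; lra.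
have wp : w * (1 - p / 2) = 1 - 2 * p by rewrite divfK// gt_eqF//; lra.
pose q := 1 - p - w.
have q0 : 0 <= q.
  rewrite -(@pmulr_lge0 _ (1 - p / 2)); last by lra.
  by rewrite /q; nra.
pose pad := p - q - w * (M / 2).
have pad0 : 0 <= pad by rewrite /pad /q; rewrite /M; nra.
(* [pos nu] and [neg nu] are w times the positive and negative parts, atom by atom. The crossed
   atoms of mass [q] lower the difference of the main atoms from 1 - p to w, and [pad], common to
   both priors, completes the contamination to mass p. *)
pose pos s := [seq (a.1, w * ((`|a.2| + a.2) / 2)) | a : R * R <- s].
pose neg s := [seq (a.1, w * ((`|a.2| - a.2) / 2)) | a : R * R <- s].
pose r0 := [:: (0, pad), (t, q) & pos nu].
pose r1 := [:: (0, pad), (0, q) & neg nu].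
have wr0 : nonneg_weights r0.
  move=> a; rewrite !inE => /or3P[/eqP->//|/eqP->//|/mapP[b _ ->]] /=.
  by rewrite mulr_ge0// divr_ge0//; have := ler_norm (- b.2); rewrite normrN; lra.
have wr1 : nonneg_weights r1.
  move=> a; rewrite !inE => /or3P[/eqP->//|/eqP->//|/mapP[b _ ->]] /=.
  by rewrite mulr_ge0// divr_ge0//; have := ler_norm b.2; lra.
have sr0 : \sum_(a <- r0) a.2 = p.
  rewrite !big_cons big_map/= -mulr_sumr -mulr_suml big_split/= nu0.
  by rewrite -/M /pad; ring.
have sr1 : \sum_(a <- r1) a.2 = p.
  rewrite !big_cons big_map/= -mulr_sumr -mulr_suml sumrB/= nu0.
  by rewrite -/M /pad; ring.
pose s0 := (0, 1 - p) :: r0; pose s1 := (t, 1 - p) :: r1.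
have ws0 : nonneg_weights s0.
  by move=> a; rewrite inE => /predU1P[->/=|]; [lra|exact: wr0].
have ws1 : nonneg_weights s1.
  by move=> a; rewrite inE => /predU1P[->/=|]; [lra|exact: wr1].
have ss0 : \sum_(a <- s0) a.2 = 1 by rewrite big_cons sr0/=; ring.
have ss1 : \sum_(a <- s1) a.2 = 1 by rewrite big_cons sr1/=; ring.
(* Writing g0 for [gmix s0] and d for w [gmix mu], the density of [h] is g0 + 2d + 2d^2, and g0
   times it exceeds (g0 + d)^2 by (2 g0 - 1) d^2, nonnegative as g0 >= 1/2. *)
pose h := scale_weights 2 s1 ++ scale_weights (-1) s0 ++
  scale_weights (2 * w ^+ 2) (gmix_square mu).
have posneg x : gmix (pos nu) x - gmix (neg nu) x = w * gmix nu x.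
  rewrite /gmix !big_map -sumrB mulr_sumr; apply: eq_bigr => a _ /=.
  by field.
have muE x : gmix mu x = gexp t x - gexp 0 x - gmix nu x.
  by rewrite /mu /perturbation !gmix_cons gmix_scale /=; ring.
have D x : gmix s1 x = gmix s0 x + w * gmix mu x.
  rewrite muE /s0 /s1 /r0 /r1 !gmix_cons /=.
  by have := posneg x; rewrite /q; lra.
have g0_ge x : 1 / 2 <= gmix s0 x.
  rewrite gmix_cons /= gexp0; have := gmix_ge0 x wr0; lra.
have hE x : gmix h x = gmix s0 x + 2 * (w * gmix mu x) + 2 * (w * gmix mu x) ^+ 2.
  rewrite /h !gmix_cat !gmix_scale gmix_squareE D; ring.
have hle x : gmix s1 x ^+ 2 <= gmix s0 x * gmix h x.
  rewrite hE D; have := g0_ge x; have := sqr_ge0 (w * gmix mu x); nra.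
have h0 x : 0 <= gmix h x.
  rewrite -(@pmulr_rge0 _ (gmix s0 x)); last by have := g0_ge x; lra.
  exact: le_trans (sqr_ge0 _) (hle x).
have sh : \sum_(a <- h) a.2 = 1 + 2 * w ^+ 2 * K.
  by rewrite /h !big_cat !sum_scale_weights ss0 ss1 sum_gmix_square -/K /=; ring.
have sh0 : 0 <= 1 + 2 * w ^+ 2 * K.
  by rewrite -sh -lee_fin -integral_gmix; apply: integral_ge0 => x _; rewrite lee_fin.
have K0 : 0 <= K.
  rewrite /K -sum_gmix_square -lee_fin -integral_gmix; apply: integral_ge0 => x _.
  by rewrite lee_fin gmix_squareE sqr_ge0.
(* From p < 1/2, 1 - p/2 > 3/4. As (4/3)^2 <= 2, the constant 8 in the hypothesis then bounds n
   times 2 w^2 K by 1/2. *)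
have wle : w <= 4 / 3 * (1 - 2 * p) by nra.
have tl th rest : nonneg_weights rest -> \sum_(a <- rest) a.2 = p ->
    expR (- (lam * k%:R)) *
    (\sum_(a <- (th, 1 - p) :: rest) a.2 * outlier lam th a.1) ^+ n <= 1 / 8.
  move=> wrest srest; apply: le_trans tail.
  rewrite ler_wpM2l ?expR_ge0// lerXn2r ?nnegrE ?sum_outlier_le//.
    rewrite big_seq; apply: sumr_ge0 => a; rewrite inE => aa.
    rewrite mulr_ge0//; last by rewrite /outlier; case: ifP; rewrite ?expR_ge0.
    by case/predU1P: aa => [->/=|/wrest//]; lra.
  by rewrite addr_ge0// mulr_ge0// subr_ge0 -[leLHS]expR0 ler_expR.
apply: (@risk_lower_bound R n k 0 t r lam s0 s1 h) => //; try exact: tl.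
- rewrite sh; apply: expr1D_le2 => //.
  have H : 2 * w ^+ 2 * K <= 8 * (1 - 2 * p) ^+ 2 * K / 2.
    have : w ^+ 2 <= (4 / 3 * (1 - 2 * p)) ^+ 2 by rewrite lerXn2r ?nnegrE//; lra.
    by have := sqr_ge0 (1 - 2 * p); nra.
  have := ler_wpM2l (ler0n R n) H; lra.
- by rewrite subr0 gtr0_norm//; lra.
Qed.

End prior_pair.

(** * The hyperbolic sine expansion *)

Section sinh_expansion.
Variable R : realType.
Implicit Types (t u y h : R) (k K n : nat).

Definition sinh u : R := (expR u - expR (- u)) / 2.
Definition cosh u : R := (expR u + expR (- u)) / 2.

Lemma sinh0 : sinh 0 = 0. Proof. by rewrite /sinh oppr0 subrr mul0r. Qed.
Lemma cosh0 : cosh 0 = 1. Proof. by rewrite /cosh oppr0 expR0; field. Qed.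

Lemma sinhN u : sinh (- u) = - sinh u.
Proof. by rewrite /sinh opprK; field. Qed.

Lemma cosh2_sinh2 u : cosh u ^+ 2 = 1 + sinh u ^+ 2.
Proof.
have H : expR u * expR (- u) = 1 by rewrite -expRD subrr expR0.
rewrite /cosh /sinh; nra.
Qed.

Lemma sinh_ge0 u : 0 <= u -> 0 <= sinh u.
Proof.
by move=> u0; rewrite divr_ge0// subr_ge0 ler_expR; lra.
Qed.

Lemma norm_sinh u : `|sinh u| = sinh `|u|.
Proof.
have [u0|u0] := lerP 0 u; first by rewrite !ger0_norm ?sinh_ge0.
rewrite (ltr0_norm u0) -[in LHS](opprK u) sinhN normrN ger0_norm// sinh_ge0//.
by rewrite oppr_ge0 ltW.
Qed.

Lemma sinh_le2 u : 0 <= u -> u <= 1 / 4 -> sinh u <= 2 * u.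
Proof.
move=> u0 u4; have H1 := expR_ge1Dx (- u).
have H2 : expR u * expR (- u) = 1 by rewrite -expRD subrr expR0.
have H3 := expR_gt0 u.
have H4 : expR u * (1 - u) <= 1 by rewrite -[leRHS]H2 ler_wpM2l// ltW.
by rewrite /sinh; nra.
Qed.

Global Instance is_derive_sinh u : is_derive u 1 sinh (cosh u).
Proof.
rewrite /sinh /cosh; apply: is_derive_eq; rewrite /GRing.scale/=.
by field.
Qed.

Global Instance is_derive_cosh u : is_derive u 1 cosh (sinh u).
Proof.
rewrite /sinh /cosh; apply: is_derive_eq; rewrite /GRing.scale/=.
by field.
Qed.

Global Instance is_derive_sinhX n u :
  is_derive u 1 (fun v => sinh v ^+ n) (n%:R * sinh u ^+ n.-1 * cosh u).
Proof.
have := is_deriveX n (is_derive_sinh u).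
rewrite (_ : sinh ^+ n = fun v => sinh v ^+ n) //; last first.
  by apply/funext => v; rewrite exprfctE.
Qed.

Lemma is_derive_ge0_le (f df : R -> R) u :
  (forall v : R, is_derive v 1 f (df v)) -> (forall v, 0 <= v -> 0 <= df v) ->
  0 <= u -> f 0 <= f u.
Proof.
move=> fdf df0 u0.
have cf : {within `[0, u], continuous f}.
  apply: derivable_within_continuous => v _.
  by have [] := fdf v.
have [v] := @MVT_segment R f df 0 u u0 (fun v _ => fdf v) cf.
rewrite in_itv/= subr0 => /andP[v0 _] e.
by rewrite -subr_ge0 e mulr_ge0// df0.
Qed.

(* The operator D^2 - t^2 factors as (D - t)(D + t), and each first-order factor
   preserves nonnegativity from zero initial data. *)
Lemma second_order_comparison t (f f1 f2 : R -> R) u :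
  (forall v : R, is_derive v 1 f (f1 v)) -> (forall v : R, is_derive v 1 f1 (f2 v)) ->
  f 0 = 0 -> f1 0 = 0 -> (forall v, 0 <= v -> 0 <= f2 v - t ^+ 2 * f v) ->
  0 <= u -> 0 <= f u.
Proof.
move=> df df1 f00 f10 Hf u0.
pose g v := expR (- (t * v)) * (f1 v + t * f v).
have g0 v : 0 <= v -> 0 <= g v.
  move=> v0; suff: g 0 <= g v by rewrite /g f10 f00 mulr0 addr0 mulr0.
  apply: (@is_derive_ge0_le _ (fun v => expR (- (t * v)) * (f2 v - t ^+ 2 * f v))) => // w.
    apply: is_derive_eq; rewrite /GRing.scale/=; ring.
  by move=> w0; rewrite mulr_ge0 ?expR_ge0// Hf.
have fg v : 0 <= v -> 0 <= f1 v + t * f v.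
  by move=> /g0; rewrite pmulr_rge0// expR_gt0.
pose k v := expR (t * v) * f v.
have : k 0 <= k u.
  apply: (@is_derive_ge0_le _ (fun v => expR (t * v) * (f1 v + t * f v))) => // w.
    apply: is_derive_eq; rewrite /GRing.scale/=; ring.
  by move=> w0; rewrite mulr_ge0 ?expR_ge0// fg.
by rewrite /k f00 mulr0 pmulr_rge0// expR_gt0.
Qed.

(* The coefficients of [sin (t * asin s)] as a power series in [s], all of them
   nonnegative for [0 <= t <= 1]; [sinh (t * asinh s)] has the same
   coefficients with alternating signs. *)
Fixpoint sin_asin_coef t k : R :=
  if k is k'.+1 then
    sin_asin_coef t k' * ((2 * k'%:R + 1) ^+ 2 - t ^+ 2)
      / ((2 * k'%:R + 3) * (2 * k'%:R + 2))
  else t.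

Section bounds.
Variable t : R.
Hypotheses (t0 : 0 <= t) (t1 : t <= 1).
Local Notation b := (sin_asin_coef t).

Lemma sin_asin_coefS k :
  b k.+1 * ((2 * k%:R + 3) * (2 * k%:R + 2)) = b k * ((2 * k%:R + 1) ^+ 2 - t ^+ 2).
Proof.
rewrite /= divfK// gt_eqF//; have : 0 <= k%:R :> R by []; nra.
Qed.

Lemma sin_asin_coef_ge0 k : 0 <= b k.
Proof.
elim: k => [//|k IH] /=; have k0 : 0 <= k%:R :> R by [].
have t2 : t ^+ 2 <= 1 by rewrite expr_le1.
have d0 : 0 <= (2 * k%:R + 3) * (2 * k%:R + 2) :> R by rewrite mulr_ge0//; lra.
have n0 : 0 <= (2 * k%:R + 1) ^+ 2 - t ^+ 2 by have := sqr_ge0 (k%:R : R); nra.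
by rewrite divr_ge0// mulr_ge0.
Qed.

(** Telescoping with the potential 2 (2K + 1) b_K, an equality at K = 0: the recurrence gives 2 (2K
    + 3) b_(K+1) <= (4K + 1) b_K, so each b_K is at most the drop of the potential. *)
Lemma sum_sin_asin_coef K :
  \sum_(k < K) b k <= 2 * t - 2 * (2 * K%:R + 1) * b K.
Proof.
elim: K => [|K IH]; first by rewrite big_ord0 /=; lra.
rewrite big_ord_recr [leLHS]/=; set S := \sum_(k < K) _ in IH *.
have := sin_asin_coefS K; have := sin_asin_coef_ge0 K.
have := sin_asin_coef_ge0 K.+1.
rewrite -[K.+1%:R]natr1; set x := b K.+1; set y := b K; have : 0 <= K%:R :> R by [].
move: IH; rewrite -/y => IH; move: K%:R IH => z IH z0 x0 y0 e.
suff : 2 * (2 * z + 3) * x <= (4 * z + 1) * y.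
  by move: IH; lra.
rewrite -(@ler_pM2r _ (2 * z + 2)); last by lra.
have -> : 2 * (2 * z + 3) * x * (2 * z + 2) = 2 * (y * ((2 * z + 1) ^+ 2 - t ^+ 2)).
  by rewrite -e; ring.
have : 0 <= y * z by rewrite mulr_ge0.
have : 0 <= y * t ^+ 2 by rewrite mulr_ge0// sqr_ge0.
by nra.
Qed.

Lemma sin_asin_coef_le K : b K <= t.
Proof.
have := sum_sin_asin_coef K; have : 0 <= \sum_(k < K) b k.
  by apply: sumr_ge0 => k _; exact: sin_asin_coef_ge0.
have := sin_asin_coef_ge0 K; have : 0 <= K%:R :> R by [].
nra.
Qed.

Definition sinh_partial K u : R :=
  \sum_(k < K) (-1) ^+ k * b k * sinh u ^+ (2 * k + 1).
Definition sinh_partial1 K u : R :=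
  \sum_(k < K) (-1) ^+ k * b k * ((2 * k%:R + 1) * sinh u ^+ (2 * k) * cosh u).
(** The second derivative of [sinh_partial], with cosh^2 replaced by 1 + sinh^2. The truncated
    exponent [(2 * k).-1] is harmless at k = 0, where the factor 2k vanishes. *)
Definition sinh_partial2 K u : R :=
  \sum_(k < K) (-1) ^+ k * b k * ((2 * k%:R + 1) ^+ 2 * sinh u ^+ (2 * k + 1)
    + (2 * k%:R + 1) * (2 * k%:R) * sinh u ^+ (2 * k).-1).

Lemma sinh_partialN K u : sinh_partial K (- u) = - sinh_partial K u.
Proof.
rewrite /sinh_partial -sumrN; apply: eq_bigr => k _.
rewrite sinhN [(- sinh u) ^+ _]exprNn addn1 mul2n [(-1) ^+ _.+1]exprS.
by rewrite -[(-1) ^+ k.*2]signr_odd odd_double; ring.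
Qed.

Lemma is_derive_sinh_partial K u :
  is_derive u 1 (sinh_partial K) (sinh_partial1 K u).
Proof.
elim: K => [|K IH].
  rewrite (_ : sinh_partial 0 = cst 0); last first.
    by apply/funext => v; rewrite /sinh_partial big_ord0.
  by rewrite /sinh_partial1 big_ord0; exact: is_derive_cst.
rewrite (_ : sinh_partial K.+1 =
    fun v => sinh_partial K v + (-1) ^+ K * b K * sinh v ^+ (2 * K + 1)); last first.
  by apply/funext => v; rewrite /sinh_partial big_ord_recr.
apply: is_derive_eq; rewrite /sinh_partial1 big_ord_recr/= /GRing.scale/=.
by rewrite addn1 /= -[(2 * K).+1%:R]natr1 natrM; ring.
Qed.

Lemma is_derive_sinh_partial1 K u :
  is_derive u 1 (sinh_partial1 K) (sinh_partial2 K u).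
Proof.
elim: K => [|K IH].
  rewrite (_ : sinh_partial1 0 = cst 0); last first.
    by apply/funext => v; rewrite /sinh_partial1 big_ord0.
  by rewrite /sinh_partial2 big_ord0; exact: is_derive_cst.
rewrite (_ : sinh_partial1 K.+1 = fun v => sinh_partial1 K v +
    (-1) ^+ K * b K * ((2 * K%:R + 1) * sinh v ^+ (2 * K) * cosh v)); last first.
  by apply/funext => v; rewrite /sinh_partial1 big_ord_recr.
apply: is_derive_eq; rewrite /sinh_partial2 big_ord_recr/= /GRing.scale/=.
rewrite addn1 natrM [sinh u ^+ (2 * K).+1]exprSr; congr (_ + _ * _).
have E : 2 * K%:R * sinh u ^+ (2 * K).-1 * sinh u ^+ 2 = 2 * K%:R * sinh u ^+ (2 * K) * sinh u.
  case: (K) => [|k]; first by rewrite mulr0 !mul0r.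
  by rewrite -!mulrA -exprSr -exprD addn2 prednK ?muln_gt0.
rewrite (_ : cosh u * _ =
  (2 * K%:R + 1) * (2 * K%:R * sinh u ^+ (2 * K).-1 * cosh u ^+ 2)); last by ring.
rewrite cosh2_sinh2 mulrDr E; ring.
Qed.

(** The recurrence cancels all powers of sinh u but one: the term that the first omitted summand
    would have compensated. For u >= 0 its sign is (-1)^(K+1), as [second_order_comparison]
    requires. *)
Lemma sinh_partial_ode K u :
  sinh_partial2 K u - t ^+ 2 * sinh_partial K u
  = - ((-1) ^+ K * b K * ((2 * K%:R + 1) * (2 * K%:R)) * sinh u ^+ (2 * K).-1).
Proof.
elim: K => [|K IH].
  by rewrite /sinh_partial2 /sinh_partial !big_ord0 !mulr0 mul0r subrr oppr0.
rewrite /sinh_partial2 /sinh_partial !big_ord_recr.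
rewrite -/(sinh_partial2 K u) -/(sinh_partial K u).
rewrite (_ : (2 * K.+1).-1 = (2 * K + 1)%N); last by rewrite mulnS addn1.
have := sin_asin_coefS K; move: IH; rewrite -[K.+1%:R]natr1 [(-1) ^+ K.+1]exprS.
move: (b K.+1) (b K) (sinh u ^+ (2 * K + 1)) (sinh u ^+ (2 * K).-1) (sinh_partial2 K u).
move=> x y P S A IH e /=.
have -> : A = t ^+ 2 * sinh_partial K u -
    (-1) ^+ K * y * ((2 * K%:R + 1) * (2 * K%:R)) * S by rewrite -IH; ring.
apply/eqP; rewrite -subr_eq0; apply/eqP.
transitivity ((-1) ^+ K * P * (y * ((2 * K%:R + 1) ^+ 2 - t ^+ 2)
    - x * ((2 * K%:R + 3) * (2 * K%:R + 2)))); last by rewrite e subrr mulr0.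
ring.
Qed.

(* Consecutive partial sums bracket [sinh (t u)]. *)
Lemma sinh_partial_sign K u : 0 <= u ->
  0 <= (-1) ^+ K * (sinh (t * u) - sinh_partial K u).
Proof.
move=> u0; case: K => [|K].
  by rewrite /sinh_partial big_ord0 mul1r subr0 sinh_ge0// mulr_ge0.
pose f (v : R) : R := (-1) ^+ K.+1 * (sinh (t * v) - sinh_partial K.+1 v).
pose f1 (v : R) : R := (-1) ^+ K.+1 * (t * cosh (t * v) - sinh_partial1 K.+1 v).
pose f2 (v : R) : R := (-1) ^+ K.+1 * (t ^+ 2 * sinh (t * v) - sinh_partial2 K.+1 v).
have df (v : R) : is_derive v 1 f (f1 v).
  have dP := is_derive_sinh_partial K.+1 v.
  rewrite /f /f1; apply: is_derive_eq; rewrite /GRing.scale/=; ring.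
have df1 (v : R) : is_derive v 1 f1 (f2 v).
  have dP := is_derive_sinh_partial1 K.+1 v.
  rewrite /f1 /f2; apply: is_derive_eq; rewrite /GRing.scale/=; ring.
have f0 : f 0 = 0.
  rewrite /f mulr0 sinh0 /sinh_partial big1 ?subrr ?mulr0// => i _.
  by rewrite sinh0 addn1 exprS mul0r mulr0.
have f10 : f1 0 = 0.
  rewrite /f1 mulr0 cosh0 /sinh_partial1 big_ord_recl big1 ?addr0.
    by rewrite /= muln0 !expr0 cosh0; ring.
  by move=> i _; rewrite lift0 sinh0 expr0n muln_eq0 /= mulr0 mul0r mulr0.
have Hf v : 0 <= v -> 0 <= f2 v - t ^+ 2 * f v.
  move=> v0; have ode := sinh_partial_ode K.+1 v.
  rewrite /f2 /f (_ : _ - _ = (-1) ^+ K.+1 *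
    - (sinh_partial2 K.+1 v - t ^+ 2 * sinh_partial K.+1 v)); last by ring.
  rewrite ode opprK; have s0 := exprn_ge0 (2 * K.+1).-1 (sinh_ge0 v0).
  have K0 : 0 <= K.+1%:R :> R by [].
  move: (b K.+1) K.+1%:R (sinh v ^+ _) (sin_asin_coef_ge0 K.+1) K0 s0 => x y z x0 y0 z0.
  have y1 : 0 <= 2 * y + 1 by lra.
  by rewrite !mulrA -expr2 sqrr_sign mul1r !mulr_ge0.
exact: (second_order_comparison df df1 f0 f10 Hf u0).
Qed.

(** The bracketing at K and K + 1 bounds the error by the first omitted term, and its coefficient is
    at most t; oddness covers u < 0. *)
Lemma sinh_partial_error K u :
  `|sinh (t * u) - sinh_partial K u| <= t * `|sinh u| ^+ (2 * K + 1).
Proof.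
wlog u0 : u / 0 <= u => [H|].
  have [u0|/ltW u0] := lerP 0 u; first exact: H.
  have := H (- u); rewrite oppr_ge0 mulrN !sinhN normrN => /(_ u0).
  by rewrite sinh_partialN -opprD normrN.
have H0 := sinh_partial_sign K u0.
have s0 : 0 <= sinh u ^+ (2 * K + 1) by rewrite exprn_ge0// sinh_ge0.
have := sinh_partial_sign K.+1 u0.
rewrite {1}/sinh_partial big_ord_recr /= -/(sinh_partial K u) => H1.
rewrite (ger0_norm (sinh_ge0 u0)).
apply: (@le_trans _ _ (b K * sinh u ^+ (2 * K + 1))); last first.
  by rewrite ler_wpM2r// sin_asin_coef_le.
rewrite -[leLHS]mul1r -[X in X * _](@normr_sign R K) -normrM ger0_norm// -subr_ge0.
move: H1; rewrite exprS; congr (0 <= _).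
set E := (-1) ^+ K; have EE : E * E = 1 by rewrite -expr2 sqrr_sign.
transitivity ((E * E) * (b K * sinh u ^+ (2 * K + 1)) - E * (sinh (t * u) - sinh_partial K u)).
  by ring.
by rewrite EE mul1r.
Qed.

End bounds.
End sinh_expansion.

(** * Signed atomic measures and their Laplace transforms *)

Section sinh_measures.
Variable R : realType.
Implicit Types (s nu : seq (R * R)) (t u y h M B : R) (k K n : nat).

(* [F] is the bilateral Laplace transform of a finitely supported signed measure
   on [-B, B] of total mass at most [M]. *)
Definition atomic_laplace M B (F : R -> R) := exists nu,
  [/\ \sum_(a <- nu) `|a.2| <= M, {in nu, forall a, `|a.1| <= B} &
      forall y, laplace nu y = F y].

Lemma atomic_laplace_le M B M' B' F G :
  atomic_laplace M B F -> M <= M' -> B <= B' -> F =1 G -> atomic_laplace M' B' G.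
Proof.
move=> [nu [nuM nuB nuF]] MM BB FG; exists nu; split.
- exact: le_trans nuM MM.
- by move=> a /nuB aB; exact: le_trans aB BB.
- by move=> y; rewrite nuF FG.
Qed.

Lemma atomic_laplace0 B : atomic_laplace 0 B (fun=> 0).
Proof. by exists [::]; split=> [|a|y]//; rewrite /laplace big_nil. Qed.

Lemma atomic_laplace_exp x : atomic_laplace 1 `|x| (fun y => expR (x * y)).
Proof.
exists [:: (x, 1)]; split=> [|a|y].
- by rewrite big_seq1 normr1.
- by rewrite inE => /eqP ->.
- by rewrite /laplace big_seq1 mul1r.
Qed.

Lemma atomic_laplaceD M1 M2 B F G :
  atomic_laplace M1 B F -> atomic_laplace M2 B G ->
  atomic_laplace (M1 + M2) B (fun y => F y + G y).
Proof.
move=> [n1 [m1 b1 f1]] [n2 [m2 b2 f2]]; exists (n1 ++ n2); split.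
- by rewrite big_cat lerD.
- by move=> a; rewrite mem_cat => /orP[/b1|/b2].
- by move=> y; rewrite -f1 -f2 /laplace big_cat.
Qed.

Lemma atomic_laplaceZ c M B F :
  atomic_laplace M B F -> atomic_laplace (`|c| * M) B (fun y => c * F y).
Proof.
move=> [nu [m b f]]; exists (scale_weights c nu); split.
- rewrite big_map (eq_bigr (fun a => `|c| * `|a.2|)); last by move=> a _; rewrite normrM.
  by rewrite -mulr_sumr ler_wpM2l.
- by move=> _ /mapP[a /b ? ->].
- move=> y; rewrite -f /laplace big_map mulr_sumr; apply: eq_bigr => a _.
  by rewrite /= mulrA.
Qed.

(** Convolution of the two measures: mass bounds multiply and support radii add. *)
Lemma atomic_laplaceM M1 M2 B1 B2 F G : 0 <= M1 ->
  atomic_laplace M1 B1 F -> atomic_laplace M2 B2 G ->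
  atomic_laplace (M1 * M2) (B1 + B2) (fun y => F y * G y).
Proof.
move=> M10 [n1 [m1 b1 f1]] [n2 [m2 b2 f2]].
exists [seq (a.1 + b.1, a.2 * b.2) | a <- n1, b <- n2]; split.
- rewrite big_allpairs_dep.
  rewrite (eq_bigr (fun a => `|a.2| * \sum_(b <- n2) `|b.2|)); last first.
    by move=> a _; rewrite mulr_sumr; apply: eq_bigr => b _; rewrite normrM.
  by rewrite -mulr_suml ler_pM ?sumr_ge0.
- move=> _ /allpairsP[[a b] [/b1 aB /b2 bB ->]] /=.
  exact: le_trans (ler_normD _ _) (lerD aB bB).
- move=> y; rewrite -f1 -f2 /laplace big_allpairs_dep mulr_suml.
  apply: eq_bigr => a _; rewrite mulr_sumr; apply: eq_bigr => b _ /=.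
  by rewrite mulrDl expRD mulrACA.
Qed.

Lemma atomic_laplace_sinh h : 0 <= h -> atomic_laplace 1 h (fun y => sinh (h * y)).
Proof.
move=> h0; have hh : `|h| = h by rewrite ger0_norm.
have e1 := atomic_laplaceZ (1 / 2) (atomic_laplace_exp h).
have e2 := atomic_laplaceZ (- (1 / 2)) (atomic_laplace_exp (- h)).
rewrite (normrN h) hh in e2; rewrite hh in e1.
apply: (atomic_laplace_le (atomic_laplaceD e1 e2)) => //.
  by rewrite normrN ger0_norm; lra.
by move=> y; rewrite /sinh [- h * y]mulNr; field.
Qed.

Lemma atomic_laplace_sinhX h n : 0 <= h ->
  atomic_laplace 1 (n%:R * h) (fun y => sinh (h * y) ^+ n).
Proof.
move=> h0; elim: n => [|n IH].
  by apply: (atomic_laplace_le (atomic_laplace_exp 0)) => //=;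
    [rewrite normr0 mul0r | move=> y; rewrite mul0r expR0 expr0].
apply: (atomic_laplace_le (atomic_laplaceM ler01 (atomic_laplace_sinh h0) IH)).
- by rewrite mulr1.
- by rewrite -natr1; lra.
- by move=> y; rewrite exprS.
Qed.

(** Each power of sinh carries mass at most 1, so the coefficient sum, at most 2t, bounds the mass;
    the highest power 2K - 1 fixes the support. *)
Lemma atomic_laplace_sinh_partial t h K : 0 <= t -> t <= 1 -> 0 <= h ->
  atomic_laplace (2 * t) ((2 * K)%:R * h) (fun y => sinh_partial t K (h * y)).
Proof.
move=> t0 t1 h0.
(* The radius stays that of K throughout the induction on L, since [atomic_laplaceD] needs a common
   one. *)
have H L : (L <= K)%N -> atomic_laplace (\sum_(k < L) sin_asin_coef t k)
    ((2 * K)%:R * h) (fun y => sinh_partial t L (h * y)).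
  elim: L => [_|L IH LK].
    apply: (atomic_laplace_le (atomic_laplace0 _)) => //; first by rewrite big_ord0.
    by move=> y; rewrite /sinh_partial big_ord0.
  have e := atomic_laplaceZ ((-1) ^+ L * sin_asin_coef t L)
    (atomic_laplace_sinhX (2 * L + 1) h0).
  have {}e := atomic_laplace_le e (lexx _) (_ : _ <= (2 * K)%:R * h) (fun=> erefl).
  apply: (atomic_laplace_le (atomic_laplaceD (IH (ltnW LK)) (e _))) => //.
  - rewrite ler_wpM2r// ler_nat addn1.
    by apply: (@leq_trans (2 * L.+1)); rewrite ?leq_mul2l// mulnS addSn ltnS leqW.
  - rewrite big_ord_recr mulr1 normrM normr_sign mul1r ger0_norm//.
    exact: sin_asin_coef_ge0.
  - by move=> y; rewrite /sinh_partial big_ord_recr.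
apply: (atomic_laplace_le (H K (leqnn K))) => //.
have := sum_sin_asin_coef t0 t1 K; have := sin_asin_coef_ge0 t0 t1 K.
have : 0 <= K%:R :> R by [].
nra.
Qed.

(* With u = h y the shift by t = 2 tau h acts as multiplication by
   exp (2 tau u), and exp (2 tau u) - 1 = 2 exp (tau u) sinh (tau u). *)
Lemma matching_measure p h K : 0 <= p -> p <= 1 / 2 -> 0 < h -> (0 < K)%N ->
  12 * K%:R * h ^+ 2 <= 1 ->
  exists nu : seq (R * R),
  [/\ \sum_(a <- nu) a.2 = 0, \sum_(a <- nu) `|a.2| <= p &
   let mu := perturbation (p / 2 * h) nu in
   \sum_(a <- mu) a.2 * laplace mu a.1 <= p ^+ 2 / 4 ^+ K].
Proof.
move=> p0 p2 h0 K0 Kh; pose tau := p / 4.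
have tau0 : 0 <= tau by rewrite /tau; lra.
have tau1 : tau <= 1 by rewrite /tau; lra.
have K1 : 1 <= K%:R :> R by rewrite ler1n.
(* The transform of d_t - d_0 with sinh (tau u) replaced by its truncation. The mass is at most 2 (2
   tau) = p, and the support radius tau h + 2K h is at most 3K h. *)
pose F y := 2 * (expR (tau * h * y) * sinh_partial tau K (h * y)).
have [nu [nuM nuB nuF]] : atomic_laplace p (3 * K%:R * h) F.
  have e := atomic_laplaceZ 2 (atomic_laplaceM ler01 (atomic_laplace_exp (tau * h))
    (atomic_laplace_sinh_partial K tau0 tau1 (ltW h0))).
  apply: (atomic_laplace_le e) => //.
    by rewrite ger0_norm// /tau; lra.
  rewrite ger0_norm; last by rewrite mulr_ge0// ltW.
  by rewrite natrM; nra.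
have nu0 : \sum_(a <- nu) a.2 = 0.
  have := nuF 0; rewrite /F /laplace.
  rewrite (eq_bigr (fun a => a.2)); last by move=> a _; rewrite mulr0 expR0 mulr1.
  move=> ->; rewrite /sinh_partial big1 ?mulr0// => i _.
  by rewrite ?mulr0 sinh0 addn1 exprS mul0r mulr0.
exists nu; split=> //=; set mu := perturbation _ _.
have muE y : laplace mu y =
    2 * (expR (tau * h * y) * (sinh (tau * (h * y)) - sinh_partial tau K (h * y))).
  rewrite /laplace !big_cons big_map /= mul0r expR0.
  rewrite (eq_bigr (fun a => - (a.2 * expR (a.1 * y)))); last by move=> a _; ring.
  rewrite sumrN -/(laplace nu y) nuF /F /sinh.
  have -> : expR (p / 2 * h * y) = expR (tau * h * y) * expR (tau * h * y).
    by rewrite -expRD; congr expR; rewrite /tau; field.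
  have e1 : expR (tau * h * y) * expR (- (tau * h * y)) = 1.
    by rewrite -expRD subrr expR0.
  by rewrite !mulrA; nra.
have pow4 : 0 < 4 ^+ K :> R by rewrite exprn_gt0.
have expR4 x : x <= 1 / 4 -> expR x <= 2.
  move=> x4; have := expR_ge1Dx (- x); rewrite expRN => H.
  have e0 := expR_gt0 x; move: H; rewrite -(ler_pM2r e0) mulVf ?gt_eqF//; nra.
(* Here |sinh (h y)| <= 2c <= 1/2, so the truncation error is at most tau (2c) 4^(-K), and the
   prefactor is at most 4. It is used with c = 0 at the origin, c = tau/6 at the shift, and c = 1/4
   on the support of [nu], where 3K h^2 <= 1/4. *)
have bound y c : 0 <= c -> c <= 1 / 4 -> h * `|y| <= c ->
    `|laplace mu y| <= 4 * tau * (2 * c) * (4 ^+ K)^-1.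
  move=> c0 c4 hy; have hy0 : 0 <= h * `|y| by rewrite mulr_ge0// ltW.
  rewrite muE !normrM (ger0_norm (expR_ge0 _)) (ger0_norm (ler0n _ 2)).
  have E2 : expR (tau * h * y) <= 2.
    apply: expR4; apply: le_trans (ler_norm _) _.
    rewrite -mulrA normrM (ger0_norm tau0) normrM (gtr0_norm h0).
    by nra.
  have S1 : `|sinh (h * y)| <= 2 * c.
    rewrite norm_sinh normrM (gtr0_norm h0).
    by have := sinh_le2 hy0 (le_trans hy c4); lra.
  have S2 : `|sinh (h * y)| ^+ (2 * K + 1) <= 2 * c * (4 ^+ K)^-1.
    rewrite addn1 exprS ler_pM ?exprn_ge0// -exprVn exprM lerXn2r ?nnegrE ?exprn_ge0//.
    by have := normr_ge0 (sinh (h * y)); nra.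
  have S3 := sinh_partial_error tau0 tau1 K (h * y).
  have S4 : `|sinh (tau * (h * y)) - sinh_partial tau K (h * y)|
      <= tau * (2 * c * (4 ^+ K)^-1).
    by apply: (le_trans S3); rewrite ler_wpM2l.
  rewrite (_ : 4 * tau * (2 * c) / 4 ^+ K = 2 * (2 * (tau * (2 * c * (4 ^+ K)^-1)))).
    by rewrite ler_wpM2l// ler_pM// expR_ge0.
  by ring.
rewrite !big_cons big_map /=.
have b0 : laplace mu 0 = 0.
  apply/normr0_eq0/eqP; rewrite eq_le normr_ge0 andbT.
  by have := bound 0 0; rewrite normr0 !mulr0 !mul0r; apply => //; lra.
have bt : laplace mu (p / 2 * h) <= 4 * tau * (2 * (tau / 6)) * (4 ^+ K)^-1.
  apply: le_trans (ler_norm _) (bound _ _ _ _ _); [by lra|by lra|].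
  rewrite ger0_norm; last by rewrite mulr_ge0; lra.
  by rewrite /tau; nra.
have bn : \sum_(a <- nu) - 1 * a.2 * laplace mu a.1
    <= p * (4 * tau * (2 * (1 / 4)) * (4 ^+ K)^-1).
  apply: (@le_trans _ _ (\sum_(a <- nu) `|a.2| * (4 * tau * (2 * (1 / 4)) * (4 ^+ K)^-1))).
    rewrite big_seq [leRHS]big_seq; apply: ler_sum => a anu.
    apply: (le_trans (ler_norm _)); rewrite normrM mulN1r normrN ler_wpM2l//.
    apply: bound; [by lra|by lra|].
    by have := nuB _ anu; nra.
  rewrite -mulr_suml ler_wpM2r//.
  by rewrite mulr_ge0 ?invr_ge0 ?(ltW pow4)//; lra.
rewrite b0 mulr0 add0r mul1r; apply: (le_trans (lerD bt bn)).
have : 0 <= p ^+ 2 * (4 ^+ K)^-1 by rewrite mulr_ge0 ?sqr_ge0// invr_ge0 ltW.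
by rewrite /tau; move: (4 ^+ K)^-1 => z; lra.
Qed.

End sinh_measures.

(** * Choice of the parameters *)

Section rates.
Variable R : realType.
Implicit Types (n k K : nat).

Lemma expR_le_inv1B (z : R) : z < 1 -> expR z <= (1 - z)^-1.
Proof.
move=> z1; have := expR_ge1Dx (- z); rewrite expRN => H.
by rewrite -[leLHS]invrK lef_pV2 ?posrE ?invr_gt0 ?expR_gt0//; lra.
Qed.

Lemma expR_le1D2 (z : R) : 0 <= z -> z <= 1 / 2 -> expR z <= 1 + 2 * z.
Proof.
move=> z0 z2; apply: le_trans (expR_le_inv1B _) _; first by lra.
by rewrite -div1r ler_pdivrMr; nra.
Qed.

Lemma expRN3_le : expR (- 3) <= 1 / 8 :> R.
Proof.
have e1 : 2 <= expR 1 :> R by have := expR_ge1Dx (1 : R); lra.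
rewrite (_ : - 3 = 3%:R * - 1 :> R) ?expRM_natl ?expRN ?exprVn ?div1r; last by ring.
rewrite lef_pV2 ?posrE ?exprn_gt0 ?expR_gt0// (_ : 8 = 2 ^+ 3 :> R); last by ring.
by rewrite lerXn2r ?nnegrE ?expR_ge0.
Qed.

Lemma expR1_le4 : expR 1 <= 4 :> R.
Proof.
have e2 : expR (1 / 2) <= 2 :> R.
  apply: le_trans (expR_le_inv1B _) _; first by lra.
  by rewrite -div1r ler_pdivrMr; lra.
have -> : 1 = 1 / 2 + 1 / 2 :> R by field.
by rewrite expRD; have := expR_ge0 (1 / 2 : R); nra.
Qed.

(** The bound exp z <= 1/(1 - z) at z = S/(1 + S), for which 1/(1 - z) = 1 + S. *)
Lemma ln1D_ge (S : R) : 0 <= S -> S / (1 + S) <= ln (1 + S).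
Proof.
move=> S0; rewrite -ler_expR lnK ?posrE; last by lra.
have h : 1 - S / (1 + S) = (1 + S)^-1 by field; lra.
apply: le_trans (expR_le_inv1B _) _; last by rewrite h invrK.
by rewrite -subr_gt0 h invr_gt0; lra.
Qed.

(* Lowering the contamination level by a few standard deviations of the number
   of outliers keeps that number below [k] with high probability. *)
Lemma contamination_level n k : (2 <= n)%N -> (1 <= k)%N ->
  k%:R <= (n%:R : R) / 2 - Num.sqrt (n%:R : R) ->
  exists p lam : R, 0 <= p /\ p < 1 / 2 /\ p <= k%:R / n%:R /\ 0 <= lam /\
    expR (- (lam * k%:R)) * (1 + p * (expR lam - 1)) ^+ n <= 1 / 8 /\
    n%:R * (1 - 2 * p) <= 10 * (n%:R - 2 * k%:R) /\
    ((100 <= k)%N -> k%:R / n%:R / 2 <= p).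
Proof.
move=> n2 k1; set N : R := n%:R; set x : R := k%:R; set sn := Num.sqrt N => kn.
have N2 : 2 <= N by rewrite ler_nat.
have x1 : 1 <= x by rewrite ler1n.
have N0 : 0 < N by lra.
have snE : sn ^+ 2 = N by rewrite sqr_sqrtr// ltW.
have sn0 : 0 <= sn by exact: sqrtr_ge0.
have sn1 : 0 < sn by rewrite sqrtr_gt0.
have xN : x / N < 1 / 2 by rewrite ltr_pdivrMr//; lra.
have xN0 : 0 <= x / N by rewrite divr_ge0//; lra.
have [k100|k100] := ltnP k 100.
  (* For small k no contamination is used, and the tail is exp (-3k). If n < 400, then n = sn^2 <=
     20 sn <= 10 (n - 2k). *)
  exists 0, 3; rewrite !mulr0 mul0r addr0 expr1n mulr1 subr0 mulr1; do !split=> //; try lra.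
  - apply: le_trans expRN3_le; rewrite ler_expR; lra.
  - have x100 : x <= 100 by rewrite ler_nat ltnW.
    have [N4|N4] := leP 400 N; first by lra.
    have : sn <= 20 by rewrite -(@ler_pXn2r _ 2) ?nnegrE// snE; lra.
    by nra.
have x100 : 100 <= x by rewrite ler_nat.
pose sk := Num.sqrt x.
have skE : sk ^+ 2 = x by rewrite sqr_sqrtr//; lra.
have sk0 : 0 <= sk by exact: sqrtr_ge0.
have sk10 : 10 <= sk by rewrite -(@ler_pXn2r _ 2) ?nnegrE// skE; lra.
have sksn : sk <= sn by rewrite ler_sqrt; lra.
have pN : N * ((x - 5 * sk) / N) = x - 5 * sk by rewrite mulrC divfK// gt_eqF.
have p0 : 0 <= (x - 5 * sk) / N by rewrite divr_ge0//; nra.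
have px : (x - 5 * sk) / N <= x / N by rewrite ler_pM2r ?invr_gt0//; lra.
(* With lam = 1/sqrt k the log of the tail is at most -sqrt k + (k - 5 sqrt k)(lam + 2 lam^2) = -3 -
   10 lam. For k >= 100, 5 sqrt k <= k/2, so p stays at least k/(2n). *)
exists ((x - 5 * sk) / N), sk^-1; do !split=> //.
- exact: le_lt_trans px xN.
- by rewrite invr_ge0.
- set p := _ / N in pN p0 px *; set lam := sk^-1.
  have lamsk : lam * sk = 1 by rewrite mulVf// gt_eqF//; lra.
  have lam0 : 0 <= lam by rewrite invr_ge0.
  have lam2 : lam <= 1 / 2 by nra.
  have elam : expR lam - 1 <= lam + 2 * lam ^+ 2.
    have := expR_le_inv1B (_ : lam < 1); move=> /(_ ltac:(lra)) H.
    rewrite lerBlDr; apply: (le_trans H).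
    by rewrite -div1r ler_pdivrMr; nra.
  have elam0 : 0 <= expR lam - 1 by rewrite subr_ge0 -[leLHS]expR0 ler_expR.
  apply: le_trans expRN3_le.
  apply: (@le_trans _ _ (expR (- (lam * x)) * expR (p * (expR lam - 1)) ^+ n)).
    have z0 : 0 <= p * (expR lam - 1) by rewrite mulr_ge0.
    rewrite ler_wpM2l ?expR_ge0// lerXn2r ?nnegrE ?expR_ge0//; first by lra.
    exact: expR_ge1Dx.
  rewrite -expRM_natl -expRD ler_expR -/N mulrA pN.
  have : (x - 5 * sk) * (expR lam - 1) <= (x - 5 * sk) * (lam + 2 * lam ^+ 2).
    by rewrite ler_wpM2l//; nra.
  have -> : (x - 5 * sk) * (lam + 2 * lam ^+ 2) = lam * x + 2 * (lam * sk) ^+ 2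
      - 5 * (lam * sk) - 10 * lam * (lam * sk) by rewrite -skE; ring.
  by rewrite lamsk; lra.
- by rewrite mulrBr mulr1 mulrCA pN; lra.
- move=> _; rewrite -mulrA [_^-1 * _]mulrC mulrA ler_pM2r ?invr_gt0//; nra.
Qed.

End rates.

(** * Comparison of the separation with the logarithmic rate *)

Section rate_comparison.
Variable R : realType.

(** For S <= 100^2, ln (1 + S) >= S/(1 + S) >= S/101^2, so the rate is at most a multiple of sn/a;
    the constants compare as 202/100^2 < 1/40. *)
Lemma sqrt_ln1D_small_le (x a N sn : R) :
  0 < x -> 0 < a -> 0 < sn -> sn ^+ 2 = N ->
  x ^+ 2 * a ^+ 2 / N ^+ 3 <= 100 ^+ 2 ->
  2 * (1 / 100 ^+ 2 * (x / N) *
    (Num.sqrt (ln (1 + x ^+ 2 * a ^+ 2 / N ^+ 3)))^-1) < sn / (40 * a).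
Proof.
move=> x0 a0 sn0 snE; set S := _ / N ^+ 3; set L := ln _ => SM.
have N0 : 0 < N by rewrite -snE exprn_gt0.
have S0 : 0 < S by rewrite divr_gt0 ?mulr_gt0 ?exprn_gt0.
have L0 : 0 < L by rewrite ln_gt0//; lra.
pose l := x * a / (101 * N * sn).
have l0 : 0 < l by rewrite divr_gt0 ?mulr_gt0.
have lL : l <= Num.sqrt L.
  rewrite -(@ler_pXn2r _ 2) ?nnegrE ?(ltW l0) ?sqrtr_ge0// sqr_sqrtr ?(ltW L0)//.
  apply: (@le_trans _ _ (S / (1 + S))); last exact: ln1D_ge (ltW S0).
  have -> : l ^+ 2 = S * (101 ^+ 2)^-1.
    by rewrite /l /S -snE; field; rewrite gt_eqF.
  rewrite ler_pM2l// lef_pV2 ?posrE ?exprn_gt0//; last by lra.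
  by move: SM; clear; move: S => S; lra.
apply: (@le_lt_trans _ _ (2 * (1 / 100 ^+ 2 * (x / N) * l^-1))).
  rewrite ler_pM2l// ler_pM2l; last by rewrite mulr_gt0 ?divr_gt0 ?exprn_gt0.
  by rewrite lef_pV2 ?posrE ?sqrtr_gt0.
have -> : 2 * (1 / 100 ^+ 2 * (x / N) * l^-1) = 2 * 101 / 100 ^+ 2 * (sn / a).
  by rewrite /l; field; rewrite !gt_eqF.
have -> : sn / (40 * a) = 1 / 40 * (sn / a) by field; rewrite gt_eqF.
rewrite ltr_pM2r ?divr_gt0//; lra.
Qed.

(** Take K the integer part of ln (800 S), plus one. The lower bound uses e <= 4; the upper one uses
    800 e S <= 3200 S <= (1 + S)^2, valid as S > 100^2. *)
Lemma expansion_order_exists (S : R) : 100 ^+ 2 < S ->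
  exists K : nat, [/\ (0 < K)%N, 800 * S <= 4 ^+ K & K%:R <= 2 * ln (1 + S)].
Proof.
move=> SM; have S2 : 100 * 100 < S by rewrite -expr2.
have S1 : 1 <= 800 * S by lra.
have [K K0 [K1 K2]] : exists2 K : nat,
    (0 < K)%N & K%:R <= ln (800 * S) + 1 /\ ln (800 * S) < K%:R.
  move: (ln_ge0 S1); move: (ln _) => y y0.
  exists (Num.truncn y).+1 => //; have /andP[t1 t2] := truncn_itv y0.
  by rewrite -[_.+1%:R]natr1 lerD2r natr1.
exists K.
have S800 : 0 < 800 * S by lra.
split=> //.
- rewrite -[leLHS]lnK ?posrE//.
  apply: (@le_trans _ _ (expR K%:R)); first by rewrite ler_expR ltW.
  rewrite -[K%:R]mulr1 expRM_natl lerXn2r ?nnegrE ?expR_ge0//.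
  exact: expR1_le4.
- apply: (le_trans K1).
  rewrite -[X in _ + X](expRK 1) -lnM ?posrE ?expR_gt0//.
  have S1' : 0 < 1 + S by lra.
  have -> : 2 * ln (1 + S) = ln ((1 + S) ^+ 2) by rewrite lnXn// mulr_natl.
  rewrite ler_ln ?posrE ?exprn_gt0 ?(mulr_gt0 S800) ?expR_gt0//.
  have : 800 * S * expR 1 <= 800 * S * 4 by rewrite (ler_wpM2l (ltW S800))// expR1_le4.
  have : 100 * 100 * S <= S * S by rewrite ler_wpM2r; lra.
  lra.
Qed.

End rate_comparison.

(** * The two regimes of k^2 (n - 2k)^2 / n^3 *)

Theorem mainTheorem6 (R : realType) :
  exists C c : R, (0 < C)%R /\ (0 < c)%R /\
  forall (n k : nat), (2 <= n)%N -> (1 <= k)%N ->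
    (k%:R <= (n%:R : R) / 2 - Num.sqrt (n%:R : R))%R ->
  forall est : n.-tuple R -> R, measurable_fun setT est ->
    (c%:E <= ereal_sup
      [set p | exists (theta : R) (gamma : n.-tuple R),
         (l0norm gamma <= k)%N /\
         p = P_tg theta gamma
               [set x | (C * (k%:R / n%:R) *
                  (Num.sqrt (ln (1 + k%:R ^+ 2 * (n%:R - 2 * k%:R) ^+ 2
                                      / n%:R ^+ 3)))^-1
                  < `|est x - theta|)%R]])%E.
Proof.
exists (1 / 100 ^+ 2), (1 / 10); split; [lra|split; [lra|]].
move=> n k n2 k1 kn est mest.
have [p [lam [p0 [p2 [px [lam0 [tail [pa pk]]]]]]]] := contamination_level n2 k1 kn.
move: kn px pa pk tail.
set N : R := n%:R; set x : R := k%:R; set sn := Num.sqrt N; set a := N - 2 * x.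
set S := x ^+ 2 * a ^+ 2 / N ^+ 3; set L := ln (1 + S) => kn px pa pk tail.
have N2 : 2 <= N by rewrite ler_nat.
have x1 : 1 <= x by rewrite ler1n.
have N0 : 0 < N by lra.
have snE : sn ^+ 2 = N by rewrite sqr_sqrtr// ltW.
have sn0 : 0 < sn by rewrite sqrtr_gt0.
have a2 : 2 * sn <= a by rewrite /a; lra.
have a0 : 0 < a by lra.
have S0 : 0 < S by rewrite divr_gt0 ?mulr_gt0 ?exprn_gt0//; lra.
have L0 : 0 < L by rewrite ln_gt0//; lra.
have sL0 : 0 < Num.sqrt L by rewrite sqrtr_gt0.
have xN0 : 0 < x / N by rewrite divr_gt0//; lra.
have q0 : 0 <= 1 - 2 * p by lra.
have qa : (1 - 2 * p) ^+ 2 * N <= 100 * (a ^+ 2 / N).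
  rewrite mulrA ler_pdivlMr//.
  have : (N * (1 - 2 * p)) ^+ 2 <= (10 * a) ^+ 2.
    by rewrite lerXn2r ?nnegrE ?mulr_ge0//; lra.
  by lra.
have [SM|SM] := leP S (100 ^+ 2).
  (* With nu = 0 the quadratic form is exp (t^2) - 1 <= 2 t^2, so the constraint reads 16 * 100 *
     t^2 a^2 / n <= 1; this fixes the 40. *)
  pose t := sn / (40 * a).
  have t0 : 0 < t by rewrite divr_gt0// mulr_gt0.
  have t2E : t ^+ 2 = N / (40 ^+ 2 * a ^+ 2).
    by rewrite /t -snE; field; rewrite gt_eqF.
  have ta : t ^+ 2 * (a ^+ 2 / N) = 1 / 40 ^+ 2.
    by rewrite t2E; field; rewrite !gt_eqF.
  apply: (@risk_lower_bound_signed R n k p lam t _ [::]) => //.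
  - by apply: sqrt_ln1D_small_le => //; lra.
  - by rewrite big_nil.
  - by rewrite big_nil.
  - rewrite /perturbation /laplace /= !big_cons !big_nil /= !mul0r !mulr0 expR0.
    have t21 : t ^+ 2 <= 1 / 2.
      rewrite t2E ler_pdivrMr ?mulr_gt0 ?exprn_gt0//.
      by have := mulr_gt0 a0 a0; nra.
    have := expR_le1D2 (sqr_ge0 t) t21; rewrite -expr2 => et.
    have E0 : 0 <= expR (t ^+ 2) - 1 by have := expR_ge1Dx (t ^+ 2); have := sqr_ge0 t; lra.
    have E2 : expR (t ^+ 2) - 1 <= 2 * t ^+ 2 by lra.
    have aN : 0 <= a ^+ 2 / N by rewrite divr_ge0 ?sqr_ge0// ltW.
    have := ler_pM (mulr_ge0 (sqr_ge0 (1 - 2 * p)) (ltW N0)) E0 qa E2.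
    by rewrite -/N; lra.
(* As a <= n, a large S forces k >= 100, hence p >= k/(2n). *)
have SxN : S <= x ^+ 2 / N.
  rewrite (_ : x ^+ 2 / N = x ^+ 2 * N ^+ 2 / N ^+ 3); last by field; rewrite gt_eqF.
  rewrite ler_pM2r ?invr_gt0 ?exprn_gt0// ler_pM2l ?exprn_gt0//; last by lra.
  by rewrite lerXn2r ?nnegrE ?ltW// /a; lra.
have k100 : (100 <= k)%N.
  rewrite -(ler_nat R) -/x -(@ler_pXn2r _ 2) ?nnegrE//.
  have : x ^+ 2 / N <= x ^+ 2.
    by rewrite ler_pdivrMr// ler_peMr ?sqr_ge0//; lra.
  by lra.
have {}pk := pk k100.
have [K [K00 K4 KL]] := expansion_order_exists SM; rewrite -/L in KL.
have K0 : 1 <= K%:R :> R by rewrite ler1n.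
(* h = 1/s is the largest step with 12 K h^2 <= 1, and s^2 = 12 K <= 24 L gives the logarithmic
   factor. *)
pose s : R := Num.sqrt (12 * K%:R).
have sE : s ^+ 2 = 12 * K%:R by rewrite sqr_sqrtr//; lra.
have s0 : 0 < s by rewrite sqrtr_gt0; lra.
have Kh : 12 * K%:R * s^-1 ^+ 2 <= 1 by rewrite -sE exprVn divff// expf_neq0// gt_eqF.
have sL : s <= 5 * Num.sqrt L.
  rewrite -(@ler_pXn2r _ 2) ?nnegrE ?(ltW s0) ?(mulr_ge0 _ (ltW sL0))//.
  by rewrite sE exprMn sqr_sqrtr ?(ltW L0)//; lra.
have si0 : 0 < s^-1 by rewrite invr_gt0.
have [nu [nu0 nup nuK]] := matching_measure p0 (ltW p2) si0 K00 Kh.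
have pp : 0 < p by apply: lt_le_trans pk; rewrite divr_gt0.
apply: (@risk_lower_bound_signed R n k p lam (p / 2 * s^-1) _ nu) => //.
- by rewrite mulr_gt0// divr_gt0.
- rewrite ltr_pdivlMr// mulrC.
  have : (Num.sqrt L)^-1 * s <= 5 by rewrite mulrC ler_pdivrMr.
  have xNs : 0 <= x / N * s by rewrite mulr_ge0 ?ltW.
  move: pk => /=; have := invr_gt0 (Num.sqrt L); rewrite sL0.
  move: ((Num.sqrt L)^-1) => z z0 pk zs.
  have : x / N * (z * s) <= x / N * 5 by rewrite ler_pM2l.
  by lra.
(* The left side is at most 8 * 100 * S / 4^K, which explains the 800 in the choice of K. *)
- apply: (@le_trans _ _ (N * (8 * (1 - 2 * p) ^+ 2 * (p ^+ 2 / 4 ^+ K)))).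
    by rewrite (ler_wpM2l (ltW N0))// ler_wpM2l// mulr_ge0// sqr_ge0.
  rewrite !mulrA ler_pdivrMr ?exprn_gt0// mul1r; apply: le_trans K4.
  have p2x : p ^+ 2 <= (x / N) ^+ 2 by rewrite lerXn2r ?nnegrE// ltW.
  have := ler_pM (mulr_ge0 (sqr_ge0 (1 - 2 * p)) (ltW N0)) (sqr_ge0 p) qa p2x.
  have -> : 100 * (a ^+ 2 / N) * (x / N) ^+ 2 = 100 * S.
    by rewrite /S; field; rewrite gt_eqF.
  by lra.
Qed.
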